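(* For every real $c\ge 58$ there exists $n_0=n_0(c)$ such that for every $n\ge n_0$, every balanced tripartite graph $G$ with three parts of size $n$, with minimum degree $\delta(G)\ge n+30^5c^4n^{\frac12}$ and with minimum partial degree at least $\left(\frac15+\frac7c\right)n$, contains a copy of $K_3(2)$ as a subgraph.
   Context: A balanced tripartite graph with parts of size $n$ is a simple graph $G$ whose vertex set is the disjoint union of three sets $V_1,V_2,V_3$, each of size $n$, with no edge inside any $V_i$. For a vertex $v$, $d_G(v,V_i)$ is the number of neighbors of $v$ in $V_i$. The minimum partial degree of $G$ is $\min\{d_G(v,V_i): v\in V(G)\setminus V_i,\ i\in\{1,2,3\}\}$. $K_3(2)$ denotes the complete tripartite graph with three parts of size $2$ (the octahedral graph). $\delta(G)$ is the minimum degree of $G$. *)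

(* Defs.v *)
From mathcomp Require Import all_boot all_order all_algebra.
From mathcomp Require Import reals.

Set Implicit Arguments.
Unset Strict Implicit.
Unset Printing Implicit Defensive.

Import Order.TTheory GRing.Theory Num.Theory.

Definition simple_graph (T : finType) (e : rel T) : Prop :=
  symmetric e /\ irreflexive e.

Definition balanced_tripartite (n : nat) (T : finType) (e : rel T)
    (V : 'I_3 -> {set T}) : Prop :=
  [/\ simple_graph e,
      \bigcup_(i < 3) V i = [set: T],
      forall i j, i != j -> [disjoint V i & V j],
      forall i, #|V i| = n
    & forall i x y, x \in V i -> y \in V i -> ~~ e x y].

Definition degree_in (T : finType) (e : rel T) (v : T) (A : {set T}) : nat :=
  #|[set w in A | e v w]|.

Definition degree (T : finType) (e : rel T) (v : T) : nat :=
  degree_in e v [set: T].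

(* The default value #|T| in the two minima below bounds every degree, so it
   only matters when the range is empty. *)
Definition min_degree (T : finType) (e : rel T) : nat :=
  \big[minn/#|T|]_(v : T) degree e v.

Definition min_partial_degree (T : finType) (e : rel T)
    (V : 'I_3 -> {set T}) : nat :=
  \big[minn/#|T|]_(i < 3) \big[minn/#|T|]_(v | v \notin V i) degree_in e v (V i).

(* The first component of a vertex is its part, the second its index there. *)
Definition K3_2 : rel ('I_3 * 'I_2) := [rel x y | x.1 != y.1].

(* Not necessarily induced. *)
Definition contains_copy (S T : finType) (h : rel S) (e : rel T) : Prop :=
  exists2 f : S -> T, injective f & forall x y, h x y -> e (f x) (f y).

(* Main.v *)
Require Import Defs.
From mathcomp Require Import all_boot all_order all_algebra.
From mathcomp Require Import reals.
From mathcomp Require Import zify lra ring.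

Import Order.TTheory GRing.Theory Num.Theory.

(** Suppose that G has no octahedron.  All counting is done with natural
    numbers; [eps] below stands for an arbitrarily small fraction of n.

    Cleaning.  The link of a vertex is the bipartite graph that G induces
    between its two neighbourhoods.  If many vertices of one part had a link
    with a positive proportion of all pairs, then two of these links would share
    a dense bipartite graph, hence a 4-cycle, and the two vertices with this
    4-cycle form an octahedron.  So only boundedly many vertices have a dense
    link ([few_dense_links]).  After deleting them (which costs a constant, while
    the surplus t of the minimum degree is of order sqrt n) G behaves locally
    like a triangle-free graph: for every vertex v and for all but eps
    neighbours w of v, the common neighbourhood of v and w has size at most
    eps.  This is a [sparse_system].

    Structure.  Index the parts cyclically, V_(i+3) = V_i, and call V_(i+1) the
    next and V_(i+2) the previous part of V_i.  Let M be the largest number of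
    neighbours that a vertex has in its previous part, and m = n - M.  If v has
    M previous neighbours and w is a next neighbour of v with N(v) and N(w)
    almost disjoint, then w has at most n - M next neighbours, so (the degree
    being at least n) at least M previous ones: maximality propagates along
    forward walks v_0, v_1, ...  The sets S_i of next neighbours met on
    such a walk all have size close to m, and they close up after six steps to a
    [hexagon]: a typical vertex of S_i is joined to S_(i+1) in V_(i+1), to
    V_(i+2) minus S_(i+2) in V_(i+2), and to almost nothing else.  Reading the
    parts in the opposite order gives a second hexagon U, with sets of size k.

    Where 1/5 enters.  Up to eps, both m and k are at least mu, the minimum
    partial degree, so 3m + 2k > n.  Let b in V_i have few neighbours in
    S_(i+4), as the typical vertices of S_i do.  Either b has many neighbours in S_(i+5), which forces
    its neighbourhood to be that of a typical vertex of S_i, or b also misses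
    S_(i+2), S_(i+5), one of two sets of U joined to each other, and one of the
    two opposite sets.  These five sets are almost disjoint, so in
    the second case b has degree at most about 2n - 3m - 2k < n
    ([not_exceptional]).

    Conclusion.  Let H_i be the set of all b in V_i with few neighbours in
    S_(i+4).  A vertex of H_i has at most |H_(i+1)| + n - |H_(i+2)| neighbours
    of the expected kind.  Suppose that each of them had at least t further
    neighbours, in V_(i+1) minus H_(i+1) or in H_(i+2).  As t is large compared with
    sqrt n, these extra edges contain a 4-cycle, even one whose vertices have
    many common neighbours in the third part, so there would be an octahedron
    ([few_rich_vertices]).  Hence |H_(i+2)| < |H_(i+1)| for every i, which is
    absurd because H_i has period 6. *)

(** * Counting in finite sets *)

Section Counting.
Set Implicit Arguments.
Unset Strict Implicit.

Lemma card_sum_mem (T : finType) (A : {set T}) : #|A| = \sum_(x : T) (x \in A : nat).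
Proof. by rewrite -sum1_card big_mkcond; apply: eq_bigr => x _; case: (x \in A). Qed.

Lemma sum_sq_le (I : finType) (A : {pred I}) (f : I -> nat) :
  (\sum_(i in A) f i) ^ 2 <= #|A| * \sum_(i in A) f i ^ 2.
Proof.
have: 2 * (\sum_(i in A) f i) ^ 2 <= 2 * (#|A| * \sum_(i in A) f i ^ 2).
  have -> : 2 * (#|A| * \sum_(i in A) f i ^ 2) =
      \sum_(i in A) \sum_(j in A) (f i ^ 2 + f j ^ 2).
    transitivity (\sum_(i in A) (#|A| * f i ^ 2 + \sum_(j in A) f j ^ 2)).
      by rewrite big_split /= sum_nat_const -big_distrr /= mul2n addnn.
    by apply: eq_bigr => i _; rewrite big_split /= sum_nat_const.
  rewrite -mulnn big_distrlr /= big_distrr /=.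
  apply: leq_sum => i _; rewrite big_distrr /=; apply: leq_sum => j _ /=.
  exact: nat_Cauchy.
by rewrite leq_pmul2l.
Qed.

(** Cauchy-Schwarz on the degrees into F of the elements of U counts the pairs
    of F weighted by codegree: the diagonal pairs give the total s, the pairs of
    codegree at most D give the second term, and each of the others at most
    |U|. *)
Lemma codegree_count (I J : finType) (F : {set I}) (U : {set J}) (r : I -> J -> bool)
    (D : nat) (s := \sum_(x in F) #|[set u in U | r x u]|) :
  s ^ 2 <= #|U| * (s + #|F| ^ 2 * D +
    #|U| * #|[set p : I * I | [&& p.1 \in F, p.2 \in F, p.1 != p.2 &
              D < #|[set u in U | r p.1 u && r p.2 u]|]]|).
Proof.
pose d u := \sum_(x in F) r x u.
have sE : s = \sum_(u in U) d u.
  rewrite /s /d exchange_big /=; apply: eq_bigr => x _.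
  rewrite card_sum_mem big_mkcond [RHS]big_mkcond /=; apply: eq_bigr => u _.
  by rewrite inE; case: (u \in U).
rewrite {1}sE; apply: leq_trans (sum_sq_le _ _) _; rewrite leq_mul2l; apply/orP; right.
pose c (x y : I) := #|[set u in U | r x u && r y u]|.
have -> : \sum_(u in U) d u ^ 2 = \sum_(x in F) \sum_(y in F) c x y.
  under eq_bigr => u _ do rewrite -mulnn /d big_distrlr /=.
  rewrite exchange_big /=; apply: eq_bigr => x _.
  rewrite exchange_big /=; apply: eq_bigr => y _.
  rewrite /c card_sum_mem big_mkcond [RHS]big_mkcond /=; apply: eq_bigr => u _.
  by rewrite inE; case: (u \in U) => //=; case: (r x u); case: (r y u).
set P := [set _ | _].
have cell x y : x \in F -> y \in F ->
    c x y <= (if x == y then c x x else 0) + D + #|U| * ((x, y) \in P).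
  move=> xF yF; rewrite inE /= xF yF /=; case: eqP => [->|_] /=.
    by rewrite muln0 addn0 leq_addr.
  rewrite add0n -/(c x y); case: ltnP => /= [_|]; last by lia.
  rewrite muln1 (leq_trans _ (leq_addl _ _)) //.
  by apply: subset_leq_card; apply/subsetP => u; rewrite inE => /andP[].
pose b x y := (if x == y then c x x else 0) + D + #|U| * ((x, y) \in P).
apply: (@leq_trans (\sum_(x in F) \sum_(y in F) b x y)).
  by apply: leq_sum => x xF; apply: leq_sum => y yF; apply: cell.
have row x : x \in F ->
    \sum_(y in F) b x y = c x x + #|F| * D + #|U| * \sum_(y in F) ((x, y) \in P : nat).
  move=> xF; rewrite !big_split /= -big_mkcondr /= sum_nat_const -big_distrr /=.
  rewrite (big_pred1 x) => [//|y]; rewrite inE eq_sym.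
  by case: eqP => [->|]; rewrite ?xF ?andbF.
rewrite (eq_bigr _ row) !big_split /= sum_nat_const -big_distrr /= !leq_add //.
- apply: leq_sum => x xF.
  by apply: subset_leq_card; apply/subsetP => u; rewrite !inE andbb.
- by rewrite mulnA mulnn.
rewrite leq_mul2l; apply/orP; right.
rewrite pair_big_dep /= [leqRHS]card_sum_mem big_mkcond /=.
by apply: leq_sum => -[x y] _ /=; case: ifP.
Qed.

End Counting.

(** * Octahedra forced by extra edges and by dense links *)

Section Octahedra.
Set Implicit Arguments.
Unset Strict Implicit.

Lemma exchange_card (I J : finType) (F : {set I}) (U : {set J}) (r : I -> J -> bool) :
  \sum_(x in F) #|[set u in U | r x u]| = \sum_(u in U) #|[set x in F | r x u]|.
Proof.
under eq_bigr => x _ do rewrite -sum1dep_card big_mkcondr /=.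
rewrite exchange_big /=; apply: eq_bigr => u _.
by rewrite -sum1dep_card big_mkcondr.
Qed.

Lemma exists_double (I J : finType) (F : {set I}) (U : {set J}) (r : I -> J -> bool) :
  #|U| < \sum_(x in F) #|[set u in U | r x u]| ->
  exists2 u, u \in U & 1 < #|[set x in F | r x u]|.
Proof.
rewrite exchange_card => lt; apply/exists_inP; apply: contraLR lt.
rewrite negb_exists_in -leqNgt => /forall_inP le1.
rewrite -[leqRHS]muln1 -sum_nat_const; apply: leq_sum => u uU.
by rewrite leqNgt le1.
Qed.

Lemma card_pairs (I J : finType) (P : {set I}) (Q : {set J}) (C : {set I * J}) :
  C \subset setX P Q -> #|C| = \sum_(w in P) #|[set u in Q | (w, u) \in C]|.
Proof.
move=> /subsetP sub; under eq_bigr => w _ do rewrite -sum1dep_card big_mkcondr /=.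
rewrite (pair_big (mem P) (mem Q) (fun w u => if (w, u) \in C then 1 else 0)) /=.
rewrite -big_mkcondr /= -sum1_card; apply: eq_bigl => -[w u] /=.
by case: (boolP (_ \in C)) => [/sub|]; rewrite ?andbF // andbT inE.
Qed.

Variables (T : finType) (e : rel T).
Hypotheses (e_sym : symmetric e) (e_irr : irreflexive e).

Definition nb (v : T) : {set T} := [set w | e v w].

Definition octahedron (x y z : T * T) : bool :=
  [&& x.1 != x.2, y.1 != y.2, z.1 != z.2 &
   [&& [&& e x.1 y.1, e x.1 y.2, e x.2 y.1 & e x.2 y.2],
       [&& e x.1 z.1, e x.1 z.2, e x.2 z.1 & e x.2 z.2] &
       [&& e y.1 z.1, e y.1 z.2, e y.2 z.1 & e y.2 z.2]]].

Lemma octahedron_copy x y z : octahedron x y z -> contains_copy K3_2 e.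
Proof.
case: x y z => [x0 x1] [y0 y1] [z0 z1] /and4P[/= x01 y01 z01].
case/and3P=> /and4P[a1 a2 a3 a4] /and4P[b1 b2 b3 b4] /and4P[c1 c2 c3 c4].
have ne u v : e u v -> u <> v by move=> + uv; rewrite uv e_irr.
pose g (p : 'I_3 * 'I_2) :=
  nth x0 (nth [::] [:: [:: x0; x1]; [:: y0; y1]; [:: z0; z1]] p.1) p.2.
have adj p q : K3_2 p q -> e (g p) (g q).
  case: p q => [[[|[|[|//]]] ip] [[|[|//]] jp]] [[[|[|[|//]]] iq] [[|[|//]] jq]];
  by rewrite /K3_2 /g /= -?val_eqE //= => _; rewrite // e_sym.
exists g => // p q.
have [eq1|ne1] := eqVneq p.1 q.1; last by move/ne: (adj _ _ ne1).
case: p q eq1 => [i jp] [_ jq] /= <- E; congr pair; apply: val_inj => /=.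
move: E; case: i jp jq => [[|[|[|//]]] ip] [[|[|//]] jp] [[|[|//]] jq] //=.
all: rewrite /g /= => /eqP E; move: E x01 y01 z01; by rewrite 1?eq_sym => ->.
Qed.

Hypothesis no_octahedron : forall x y z, ~~ octahedron x y z.

(** The extra edges form the bipartite graph between F and S.  In it, for each x
    in F, a positive proportion of the pairs (s, s') of neighbours of x have
    more than 2g + 1 common neighbours in H.  If such a pair occurs for
    two vertices x, x' of F, then two of these common neighbours are also joined
    to x and x', which miss at most g elements of H each.  So each pair
    counts for one x only, and there are at most n^2 pairs. *)
Lemma few_rich_vertices (F S H : {set T}) (n t h g : nat) :
  0 < n -> #|S| <= n -> #|H| <= n ->
  (forall x, x \in F -> t <= #|S :&: nb x|) ->
  (forall x, x \in F -> #|H :\: nb x| <= g) ->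
  (forall s, s \in S -> h <= #|H :&: nb s|) ->
  4 * (2 * g + 1) * n <= h ^ 2 -> 4 * n <= t * h ->
  #|F| * (t * h) ^ 2 <= 2 * n ^ 4.
Proof.
move=> n0 Sn Hn Ft Fg Sh gh th.
pose P x := [set p : T * T | [&& p.1 \in S :&: nb x, p.2 \in S :&: nb x, p.1 != p.2 &
              2 * g + 1 < #|[set u in H | e p.1 u && e p.2 u]|]].
have Pbig x : x \in F -> (t * h) ^ 2 <= 2 * n ^ 2 * #|P x|.
  move=> xF; have := codegree_count (S :&: nb x) H e (2 * g + 1).
  rewrite -/(P x); set s := \sum_(_ in _) _.
  have ts : #|S :&: nb x| * h <= s.
    rewrite -sum_nat_const; apply: leq_sum => y; rewrite inE => /andP[yS _].
    by apply: leq_trans (Sh y yS) _; apply: subset_leq_card; apply/subsetP=> u; rewrite !inE.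
  have := Ft x xF; move: ts; move: #|S :&: nb x| #|P x| #|H| Hn s => q p H' Hn' s qs tq.
  move=> bound.
  have sn : 4 * n <= s by nia.
  have tqh : t * h <= q * h by nia.
  have b2 : s ^ 2 <= n * (s + q ^ 2 * (2 * g + 1) + n * p).
    by apply: (leq_trans bound); rewrite leq_mul // leq_add2l leq_mul.
  have b3 : 4 * (n * (q ^ 2 * (2 * g + 1))) <= s ^ 2.
    apply: (@leq_trans (q ^ 2 * h ^ 2)); last by rewrite -expnMn leq_sqr.
    by rewrite (_ : 4 * _ = q ^ 2 * (4 * (2 * g + 1) * n)) ?leq_mul2l ?gh ?orbT //; lia.
  have b4 : 4 * (n * s) <= s ^ 2 by rewrite -mulnn mulnA leq_mul2r sn orbT.
  have b5 : s ^ 2 <= 2 * n ^ 2 * p by move: b2 b3 b4; rewrite -(mulnn n); lia.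
  by apply: leq_trans b5; rewrite leq_sqr; lia.
rewrite leqNgt; apply/negP => big.
have /exists_double[[s s'] _ /card_gt1P[x [x' [/= ]]]] :
    #|setX S S| < \sum_(x in F) #|[set p in setX S S | p \in P x]|.
  apply: (@leq_ltn_trans (n ^ 2)); first by rewrite cardsX -mulnn leq_mul.
  rewrite -(@ltn_pmul2l (2 * n ^ 2)); last by rewrite muln_gt0 expn_gt0 n0.
  rewrite big_distrr /=; apply: leq_trans (_ : #|F| * (t * h) ^ 2 <= _).
    by rewrite -mulnA -expnD.
  rewrite -sum_nat_const; apply: leq_sum => x xF; apply: leq_trans (Pbig x xF) _.
  rewrite leq_mul2l; apply/orP; right; apply: subset_leq_card; apply/subsetP => p.
  by rewrite !inE => /and4P[/andP[-> ->] /andP[-> ->] -> ->].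
rewrite !inE /= => /andP[xF /and4P[/andP[sS xs] /andP[s'S xs'] nss D]].
move=> /andP[x'F /and4P[/andP[_ x's] /andP[_ x's'] _ _]] nxx.
have /card_gt1P[z [z' []]] : 1 < #|[set u in H | e s u && e s' u] :&: nb x :&: nb x'|.
  have := Fg x xF; have := Fg x' x'F; move: D.
  set C := [set _ in _ | _] => D g1 g2.
  have : #|C| <= #|C :&: nb x :&: nb x'| + #|H :\: nb x| + #|H :\: nb x'|.
    rewrite !card_sum_mem -!big_split /=; apply: leq_sum => u _.
    rewrite /C !inE; case: (u \in H); case: (e x u); case: (e x' u);
      by case: (e s u); case: (e s' u).
  lia.
rewrite !inE => /andP[/andP[/and3P[zH sz s'z] xz] x'z].
move=> /andP[/andP[/and3P[z'H sz' s'z'] xz'] x'z'] nzz.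
have := no_octahedron (x, x') (s, s') (z, z').
by rewrite /octahedron /= nxx nss nzz xs xs' x's x's' xz xz' x'z x'z' sz sz' s'z s'z'.
Qed.

Definition link (P Q : {set T}) (v : T) : {set T * T} :=
  [set p in setX P Q | [&& e v p.1, e v p.2 & e p.1 p.2]].

(** If the conclusion fails, two of the links share more than D edges, which is
    enough for a 4-cycle in their intersection. *)
Lemma few_dense_links (K P Q : {set T}) (n E D : nat) :
  #|P| <= n -> #|Q| <= n -> (forall v, v \in K -> E <= #|link P Q v|) ->
  2 * n <= D -> 2 * n ^ 3 <= D ^ 2 -> 2 * n ^ 2 * D < E ^ 2 ->
  #|K| * E <= 2 * n ^ 2.
Proof.
move=> Pn Qn KE nD nD3 DE; rewrite leqNgt; apply/negP => big.
have := codegree_count K (setX P Q) (fun v p => p \in link P Q v) D.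
set s := \sum_(_ in _) _; set N := #|setX P Q|; set R := [set _ | _].
have Nn : N <= n ^ 2 by rewrite /N cardsX -mulnn leq_mul.
have sK : #|K| * E <= s.
  rewrite -sum_nat_const; apply: leq_sum => v vK; apply: leq_trans (KE v vK) _.
  by apply: subset_leq_card; apply/subsetP => p; rewrite !inE => /andP[-> ->].
have [R0|[[v v']]] := set_0Vmem R.
  rewrite R0 cards0 muln0 /= addn0 => bound.
  have b1 : s ^ 2 <= n ^ 2 * (s + #|K| ^ 2 * D).
    by apply: leq_trans bound _; rewrite leq_mul2r Nn orbT.
  have b2 : 2 * (n ^ 2 * s) <= s ^ 2.
    by rewrite mulnA -[s ^ 2]mulnn leq_mul2r (leq_trans (ltnW big)) ?orbT.
  have b3 : (#|K| * E) ^ 2 <= s ^ 2 by rewrite leq_sqr.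
  have b4 : #|K| ^ 2 * (2 * n ^ 2 * D) < #|K| ^ 2 * E ^ 2.
    by rewrite ltn_pmul2l // expn_gt0; case: (#|K|) big.
  by move: b1 b2 b3 b4; rewrite expnMn; lia.
rewrite inE => /and4P[/= vK v'K nvv DC] _.
set C := [set _ in _ | _] in DC.
have CP w u : (w, u) \in C ->
    [/\ w \in P, u \in Q, e v w, e v' w & [/\ e v u, e v' u & e w u]].
  by rewrite !inE /= => /andP[/andP[-> ->] /andP[/andP[_ /and3P[-> -> ->]]
    /andP[_ /and3P[-> -> _]]]].
move: C DC CP => C DC CP.
have := codegree_count P Q (fun w u => (w, u) \in C) 1.
rewrite -card_pairs; last first.
  by apply/subsetP => -[w u] /CP[wP uQ _ _ _]; rewrite inE wP uQ.
set R2 := [set _ | _].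
have [R0|[[w w']]] := set_0Vmem R2.
  rewrite R0 cards0 muln0 /= addn0 muln1 => bound.
  have b1 : #|C| ^ 2 <= n * (#|C| + n ^ 2).
    by apply: leq_trans bound _; rewrite leq_mul // leq_add2l leq_sqr.
  have b2 : 2 * n * #|C| <= #|C| ^ 2.
    by rewrite -[#|C| ^ 2]mulnn leq_mul2r (leq_trans nD (ltnW DC)) orbT.
  have b3 : D ^ 2 < #|C| ^ 2 by rewrite ltn_sqr.
  by move: b1 b2 b3 nD3; rewrite (expnS n 2) mulnDr -(mulnA 2 n); lia.
rewrite inE => /and4P[/= wP w'P nww /card_gt1P[u [u' []]]] + + + _.
rewrite !in_set => /andP[_ /andP[/CP[_ _ e1 e2 [e3 e4 e5]]]] /CP[_ _ e6 e7 [_ _ e8]].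
move=> /andP[_ /andP[/CP[_ _ _ _ [f3 f4 f5]]]] /CP[_ _ _ _ [_ _ f8]] nuu.
have := no_octahedron (v, v') (w, w') (u, u').
by rewrite /octahedron /= nvv nww nuu e1 e2 e3 e4 e5 e6 e7 e8 f3 f4 f5 f8.
Qed.

End Octahedra.

(** * Sparse systems and hexagons *)

(** Proves an inequality between sums of cardinals by comparing the
    contributions of a single element u; [mem_cases] then runs through the
    possible memberships of u. *)
Ltac card_pointwise u :=
  rewrite !card_sum_mem -?big_split /=; apply: leq_sum => u _;
  rewrite ?(in_setI, in_setD, in_setU).
Ltac mem_cases :=
  rewrite ?(in_setI, in_setD, in_setU);
  repeat match goal with |- context [in_mem ?x ?A] => case: (in_mem x A) end; by [].

Section Systems.
Set Implicit Arguments.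
Unset Strict Implicit.

Variables (T : finType) (e : rel T).
Hypothesis e_sym : symmetric e.
Local Notation N := (nb e).
Implicit Types V : nat -> {set T}.

Lemma subset_imp (A B : {set T}) u : A \subset B -> (u \in A) ==> (u \in B).
Proof. by move/subsetP=> AB; apply/implyP/AB. Qed.

(** The part V_(i+1) is the next part of V_i and V_(i+2) is the previous one.
    The last two fields say that most edges vw have few common neighbours,
    for w in the next and in the previous part. *)
Record sparse_system (n t mu eps : nat) V : Prop := SparseSystem {
  sys_per : forall i, V i.+3 = V i;
  sys_size : forall i, #|V i| <= n;
  sys_deg : forall i v, v \in V i -> n + t <= #|V i.+1 :&: N v| + #|V i.+2 :&: N v|;
  sys_deg1 : forall i v, v \in V i -> mu <= #|V i.+1 :&: N v|;
  sys_deg2 : forall i v, v \in V i -> mu <= #|V i.+2 :&: N v|;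
  sys_light1 : forall i v, v \in V i ->
    #|[set w in V i.+1 :&: N v | eps < #|V i.+2 :&: N v :&: N w|]| <= eps;
  sys_light2 : forall i v, v \in V i ->
    #|[set w in V i.+2 :&: N v | eps < #|V i.+1 :&: N v :&: N w|]| <= eps }.

(** Call an edge vw light when v and w have at most eps common neighbours. *)
Lemma exists_light (A B P : {set T}) v eps :
  #|[set w in A :&: N v | eps < #|B :&: N v :&: N w|]| <= eps ->
  P \subset A -> eps < #|P :&: N v| ->
  exists w, [/\ w \in P, e v w & #|B :&: N v :&: N w| <= eps].
Proof.
set H := [set _ in _ | _] => Heps PA big.
have /subsetPn[w] : ~~ (P :&: N v \subset H).
  by apply: contraTN (leq_ltn_trans Heps big) => /subset_leq_card; rewrite -leqNgt.
rewrite !inE => /andP[wP vw]; rewrite (subsetP PA) // vw /= -leqNgt => le.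
by exists w; split.
Qed.

Lemma sys_light_nb1 n t mu eps V i v (P : {set T}) :
  sparse_system n t mu eps V -> v \in V i -> P \subset V i.+1 -> eps < #|P :&: N v| ->
  exists w, [/\ w \in P, e v w & #|V i.+2 :&: N v :&: N w| <= eps].
Proof. by move=> sys vV; apply: exists_light; apply: sys_light1 sys _ _ vV. Qed.

Lemma sys_light_nb2 n t mu eps V i v (P : {set T}) :
  sparse_system n t mu eps V -> v \in V i -> P \subset V i.+2 -> eps < #|P :&: N v| ->
  exists w, [/\ w \in P, e v w & #|V i.+1 :&: N v :&: N w| <= eps].
Proof. by move=> sys vV; apply: exists_light; apply: sys_light2 sys _ _ vV. Qed.

Lemma sys_mod3 n t mu eps V i j : sparse_system n t mu eps V -> i = j %[mod 3] -> V i = V j.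
Proof.
move=> /sys_per per ij; have red k q : V (k + q * 3) = V k.
  by elim: q => [|q IH]; rewrite ?addn0 // mulSn addnCA per.
by rewrite (divn_eq i 3) (divn_eq j 3) ij ![_ * 3 + _]addnC !red.
Qed.

Lemma sys_shift n t mu eps V a :
  sparse_system n t mu eps V -> sparse_system n t mu eps (fun i => V (i + a)).
Proof. case=> per size deg d1 d2 l1 l2.
split=> [i|i|i v|i v|i v|i v|i v] /=; rewrite ?addSn.
- exact: per.
- exact: size.
- exact: deg.
- exact: d1.
- exact: d2.
- exact: l1.
- exact: l2.
Qed.

Lemma sys_reverse n t mu eps V :
  sparse_system n t mu eps V -> sparse_system n t mu eps (fun i => V i.*2).
Proof.
case=> per size deg d1 d2 l1 l2.
split=> [i|i|i v|i v|i v|i v|i v] /=; rewrite ?doubleS ?per.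
- by [].
- exact: size.
- by rewrite [leqRHS]addnC; apply: deg.
- exact: d2.
- exact: d1.
- exact: l2.
- exact: l1.
Qed.

Lemma dependent_choice (P : nat -> pred T) (Q : nat -> rel T) x0 :
  P 0 x0 -> (forall j x, P j x -> exists y, P j.+1 y && Q j x y) ->
  exists s : nat -> T, forall j, P j (s j) && Q j (s j) (s j.+1).
Proof.
move=> P0 step.
pose s := fix s j := if j is k.+1 then odflt x0 [pick y | P j y && Q k (s k) y] else x0.
have sP j : P j (s j) -> P j.+1 (s j.+1) && Q j (s j) (s j.+1).
  by move=> /step[y Py] /=; case: pickP => [z //|/(_ y)]; rewrite Py.
exists s => j; have Pj : P j (s j) by elim: j => // j /sP/andP[].
by rewrite Pj; case/andP: (sP j Pj).
Qed.

(** Q and W cannot be almost empty as seen from Q and almost complete as seen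
    from W, unless Q is small. *)
Lemma dense_sparse (Q W : {set T}) a :
  (forall v, v \in Q -> #|W :&: N v| <= a) ->
  (forall w, w \in W -> #|Q :\: N w| <= a) ->
  2 * a < #|W| -> #|Q| <= 2 * a.
Proof.
move=> Qa Wa aW.
have up : \sum_(v in Q) #|W :&: N v| <= #|Q| * a by rewrite -sum_nat_const; apply: leq_sum.
have dn : #|W| * (#|Q| - a) <= \sum_(w in W) #|Q :&: N w|.
  rewrite -sum_nat_const; apply: leq_sum => w wW.
  by rewrite leq_subLR -(cardsID (N w) Q) addnC leq_add2r Wa.
have E : \sum_(v in Q) #|W :&: N v| = \sum_(w in W) #|Q :&: N w|.
  transitivity (\sum_(v in Q) #|[set w in W | e v w]|).
    by apply: eq_bigr => v _; congr #|pred_of_set _|; apply/setP=> w; rewrite !inE.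
  rewrite exchange_card; apply: eq_bigr => w _.
  by congr #|pred_of_set _|; apply/setP=> v; rewrite !inE e_sym.
by move: #|Q| #|W| aW up dn E => q w aW up dn E; nia.
Qed.

(** Up to d exceptions, v is joined to S within B and to the complement of U
    within C. *)
Definition follows (d : nat) (B S C U : {set T}) (v : T) : Prop :=
  [/\ #|S :\: N v| <= d, #|(B :&: N v) :\: S| <= d,
      #|U :&: N v| <= d & #|(C :\: U) :\: N v| <= d].

Lemma follows_close d c (B S C U S' U' : {set T}) v :
  follows d B S C U v ->
  #|S' :\: S| <= c -> #|S :\: S'| <= c -> #|U' :\: U| <= c -> #|U :\: U'| <= c ->
  follows (d + c) B S' C U' v.
Proof.
case=> f1 f2 f3 f4 c1 c2 c3 c4; split.
- apply: leq_trans (leq_add f1 c1); card_pointwise u; mem_cases.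
- apply: leq_trans (leq_add f2 c2); card_pointwise u; mem_cases.
- apply: leq_trans (leq_add f3 c3); card_pointwise u; mem_cases.
- apply: leq_trans (leq_add f4 c4); card_pointwise u; mem_cases.
Qed.

(** In the ideal case S_0, ..., S_5 are blown-up vertices of a hexagon whose
    edges join S_i to S_(i+1), while S_i is joined to everything but S_(i+2)
    in the previous part.  [X i] consists of the typical vertices of [S i]. *)
Record hexagon (d m : nat) V (S X : nat -> {set T}) : Prop := Hexagon {
  hex_per : forall i, S (6 + i) = S i;
  hex_sub : forall i, S i \subset V i;
  hex_typ : forall i, X i \subset S i;
  hex_atyp : forall i, #|S i| <= #|X i| + d;
  hex_ge : forall i, m <= #|S i|;
  hex_le : forall i, #|S i| <= m + d;
  hex_nb : forall i v, v \in X i -> follows d (V i.+1) (S i.+1) (V i.+2) (S i.+2) v;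
  hex_opp : forall i, #|S i :&: S (3 + i)| <= d }.

End Systems.

(** * A forward walk from a vertex of maximal backward degree *)

Section ChainOfNeighbourhoods.
Set Implicit Arguments.
Unset Strict Implicit.

Variables (T : finType) (e : rel T).
Hypothesis e_sym : symmetric e.
Local Notation N := (nb e).
Variables (n t mu eps M m : nat) (V : nat -> {set T}).
Hypothesis sys : sparse_system e n t mu eps V.
Hypothesis Mm : n = m + M.
Hypothesis Mmax : forall i v, v \in V i -> #|V i.+2 :&: N v| <= M.
Hypothesis mu_big : 500 * eps < mu.

Let V3 i : V i.+3 = V i := sys_per sys i.

Lemma forward_ge i v : v \in V i -> m <= #|V i.+1 :&: N v|.
Proof. by move=> vV; have := sys_deg sys vV; have := Mmax vV; lia. Qed.

(** Maximality propagates along a light forward edge, because N v and N w are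
    almost disjoint in a part of size at most n. *)
Lemma light_step i v w a : v \in V i -> w \in V i.+1 ->
  #|V i.+2 :&: N v :&: N w| <= eps -> M <= #|V i.+2 :&: N v| + a ->
  #|V i.+2 :&: N w| <= m + a + eps /\ M <= #|V i :&: N w| + a + eps.
Proof.
move=> vV wV light Ma.
have : #|V i.+2 :&: N v| + #|V i.+2 :&: N w| <=
    #|V i.+2| + #|V i.+2 :&: N v :&: N w| by card_pointwise u; mem_cases.
have := sys_size sys i.+2; have := sys_deg sys wV; rewrite V3; lia.
Qed.

(** The walk is indexed so that the next neighbours of [s j] lie in [V j]. *)
Lemma chain_exists u : u \in V 1 -> #|V 0 :&: N u| = M ->
  exists s : nat -> T, forall j,
   [/\ s j \in V j.+2, M <= #|V j.+1 :&: N (s j)| + j.+1 * eps,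
       #|V j :&: N (s j)| <= m + j.+1 * eps,
       s j.+1 \in V j :&: N (s j) &
       #|V j.+1 :&: N (s j) :&: N (s j.+1)| <= eps].
Proof.
move=> uV uM.
pose P j x := [&& x \in V j.+2, M <= #|V j.+1 :&: N x| + j.+1 * eps &
   #|V j :&: N x| <= m + j.+1 * eps].
pose Q j x y := e x y && (#|V j.+1 :&: N x :&: N y| <= eps).
have light i v : v \in V i -> exists w, [/\ w \in V i.+1, e v w &
    #|V i.+2 :&: N v :&: N w| <= eps].
  move=> vV; apply: (sys_light_nb1 sys vV) => //.
  by have := sys_deg1 sys vV; lia.
have [x0 P0] : exists x, P 0 x.
  have [w [wV uw wl]] := light _ _ uV; exists w; rewrite /P wV mul1n.
  have := @light_step 1 u w 0 uV wV wl; rewrite V3 uM addn0 !addn0 => /(_ (leqnn M))[h1 h2].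
  by rewrite h1 h2.
have [|s sP] := @dependent_choice _ P Q x0 P0.
  move=> j x /and3P[xV xM xm]; have [w [wV xw wl]] := light _ _ xV.
  exists w; rewrite V3 in wV; rewrite !V3 in wl.
  have := @light_step j.+2 x w (j.+1 * eps) xV; rewrite !V3 => /(_ wV wl xM)[h1 h2].
  by rewrite /P /Q !V3 wV xw wl !mulSn /=; apply/andP; split=> //; lia.
exists s => j; have /andP[/and3P[a1 a2 a3] /andP[a4 a5]] := sP j.
have /andP[/and3P[b1 _ _] _] := sP j.+1.
by split=> //; rewrite !inE a4 andbT -V3.
Qed.

Variable s : nat -> T.
Hypothesis sP : forall j,
   [/\ s j \in V j.+2, M <= #|V j.+1 :&: N (s j)| + j.+1 * eps,
       #|V j :&: N (s j)| <= m + j.+1 * eps,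
       s j.+1 \in V j :&: N (s j) &
       #|V j.+1 :&: N (s j) :&: N (s j.+1)| <= eps].

Let S j := V j :&: N (s j).
(** The next vertex [s j.+1] of the walk is one of the elements of [X j]. *)
Let X j := [set w in S j | #|V j.+1 :&: N (s j) :&: N w| <= eps].

Let SV j : S j \subset V j. Proof. exact: subsetIl. Qed.
Let XS j : X j \subset S j. Proof. by apply/subsetP => w; rewrite inE => /andP[]. Qed.
Let XV j : X j \subset V j. Proof. exact: subset_trans (XS j) (SV j). Qed.

Let S_ge j : m <= #|S j|.
Proof. by have [sV _ _ _ _] := sP j; have := forward_ge sV; rewrite V3. Qed.

Let S_le j : j <= 9 -> #|S j| <= m + 10 * eps.
Proof. by rewrite /S; have [_ _ h _ _] := sP j => j9; nia. Qed.

Let s_ge j : j <= 9 -> M <= #|V j.+1 :&: N (s j)| + 10 * eps.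
Proof. by have [_ h _ _ _] := sP j => j9; nia. Qed.

Let mu_le : mu <= m + eps.
Proof.
by have [sV _ le _ _] := sP 0; have := sys_deg1 sys sV; rewrite V3; lia.
Qed.

Let m_big : 450 * eps < m. Proof. by move: mu_le mu_big; lia. Qed.

Let S_atyp j : #|S j| <= #|X j| + eps.
Proof.
have [sV _ _ _ _] := sP j; have := sys_light1 sys sV; rewrite !V3.
set H := [set _ in _ | _] => Heps.
apply: (@leq_trans (#|X j| + #|H|)); last by rewrite leq_add2l.
apply: leq_trans (leq_card_setU _ _); apply: subset_leq_card; apply/subsetP => w wS.
have [le|gt] := leqP #|V j.+1 :&: N (s j) :&: N w| eps.
  by apply/setUP; left; rewrite inE wS.
by apply/setUP; right; rewrite inE gt andbT.
Qed.

Let typ_degrees j w : j <= 9 -> w \in X j ->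
  #|V j.+1 :&: N w| <= m + 11 * eps /\ M <= #|V j.+2 :&: N w| + 11 * eps.
Proof.
move=> j9 wX; have [sV _ _ _ _] := sP j.
have wV : w \in V j.+3 by rewrite V3 (subsetP (XV j)).
have := @light_step _ _ _ (10 * eps) sV wV.
rewrite !V3; move: wX; rewrite inE => /andP[_ wl] /(_ wl (s_ge j9)); lia.
Qed.

(** The next neighbourhoods of w and of [s j.+1] both avoid the next
    neighbourhood of [s j], which has almost M elements, and both have at least
    m = n - M elements: so they almost coincide. *)
Let typ_next j w : j <= 8 -> w \in X j ->
  #|S j.+1 :\: N w| <= 12 * eps /\ #|(V j.+1 :&: N w) :\: S j.+1| <= 12 * eps.
Proof.
move=> j8 wX; have [sV _ _ _ s1] := sP j.
have wl : #|V j.+1 :&: N (s j) :&: N w| <= eps by move: wX; rewrite inE => /andP[].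
have wd := forward_ge (subsetP (XV j) _ wX).
have Sd := S_ge j.+1; have sd := s_ge (leqW j8); have Vn := sys_size sys j.+1.
have E1 : #|S j.+1 :\: N w| + #|V j.+1 :&: N w| + #|V j.+1 :&: N (s j)| <=
   #|V j.+1| + #|V j.+1 :&: N (s j) :&: N (s j.+1)| + #|V j.+1 :&: N (s j) :&: N w|.
  by rewrite /S; card_pointwise u; mem_cases.
have E2 : #|(V j.+1 :&: N w) :\: S j.+1| + #|S j.+1| + #|V j.+1 :&: N (s j)| <=
   #|V j.+1| + #|V j.+1 :&: N (s j) :&: N (s j.+1)| + #|V j.+1 :&: N (s j) :&: N w|.
  by rewrite /S; card_pointwise u; mem_cases.
lia.
Qed.

(** A light neighbour z of w in [X j.+1] is joined to almost all of [S j.+2], so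
    w is joined to almost none of it; w has almost M neighbours in that part,
    so it is joined to almost everything else. *)
Let typ_prev j w : j <= 7 -> w \in X j ->
  #|S j.+2 :&: N w| <= 13 * eps /\ #|(V j.+2 :\: S j.+2) :\: N w| <= 24 * eps.
Proof.
move=> j7 wX; have [n1 n2] := typ_next (leqW j7) wX.
have [d1 d2] := typ_degrees (leqW (leqW j7)) wX.
have wV := subsetP (XV j) _ wX.
have [|z [zX wz zl]] := sys_light_nb1 sys wV (XV j.+1).
  have E : #|S j.+1| <= #|X j.+1 :&: N w| + #|S j.+1 :\: N w| + #|S j.+1 :\: X j.+1|.
    by card_pointwise u; mem_cases.
  have := cardsID (X j.+1) (S j.+1); rewrite (setIidPr (XS _)).
  have := S_atyp j.+1; have := S_ge j.+1; lia.
have [z1 _] := typ_next (j7 : j.+1 <= 8) zX.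
have P1 : #|S j.+2 :&: N w| <= #|V j.+2 :&: N w :&: N z| + #|S j.+2 :\: N z|.
  by rewrite /S; card_pointwise u; mem_cases.
have P2 : #|(V j.+2 :\: S j.+2) :\: N w| + #|S j.+2| + #|V j.+2 :&: N w| <=
    #|V j.+2| + #|S j.+2 :&: N w|.
  by rewrite /S; card_pointwise u; mem_cases.
have := sys_size sys j.+2; have := S_ge j.+2; lia.
Qed.

(** [X j.+2] is almost empty towards [X j] and almost complete towards
    [S j.+3]. *)
Let opp j : j <= 5 -> #|S j :&: S j.+3| <= 49 * eps.
Proof.
move=> j5.
have Q : #|X j :&: S j.+3| <= 2 * (24 * eps).
  apply: (@dense_sparse _ e e_sym _ (X j.+2)) => [v|w wX|].
  - rewrite in_setI => /andP[vX _]; have [p1 _] := typ_prev (leqW (leqW j5)) vX.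
    by apply: leq_trans (leq_trans (subset_leq_card (setSI _ (XS _))) p1) _; rewrite leq_mul2r orbT.
  - have [p1 _] := @typ_next j.+2 w (leqW j5) wX.
    apply: leq_trans (leq_trans (subset_leq_card (setSD _ (subsetIr _ _))) p1) _.
    by rewrite leq_mul2r orbT.
  - have := S_ge j.+2; have := S_atyp j.+2; lia.
have E : #|S j :&: S j.+3| + #|X j| <= #|X j :&: S j.+3| + #|S j|.
  by card_pointwise u; move: (subset_imp u (XS j)); mem_cases.
have := S_atyp j; lia.
Qed.

(** [S 5] almost avoids [S 2], so it is almost completely joined to [S 0]; but it
    is joined to almost nothing outside [S 6] in the part of [S 0]. *)
Let wrap0 : #|S 0 :\: S 6| <= 49 * eps /\ #|S 6 :\: S 0| <= 59 * eps.
Proof.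
have Q : #|X 0 :\: S 6| <= 2 * (24 * eps).
  rewrite leqNgt; apply/negP => big.
  have : #|X 5 :\: S 2| <= 2 * (24 * eps).
    apply: (@dense_sparse _ e e_sym _ (X 0 :\: S 6)) big => [v|z].
    - rewrite in_setD => /andP[_ vX]; have [_] := @typ_next 5 v isT vX.
      rewrite !V3 => p; apply: leq_trans (leq_trans _ p) _; last by rewrite leq_mul2r orbT.
      by card_pointwise u; move: (subset_imp u (XV 0)); mem_cases.
    - rewrite in_setD => /andP[_ zX]; have [_ p] := @typ_prev 0 z isT zX.
      apply: leq_trans p; card_pointwise u; move: (subset_imp u (XV 5)); rewrite V3; mem_cases.
  have E : #|S 5| <= #|X 5 :\: S 2| + #|S 2 :&: S 5| + #|S 5 :\: X 5|.
    by card_pointwise u; mem_cases.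
  have := cardsID (X 5) (S 5); rewrite (setIidPr (XS _)).
  have := S_atyp 5; have := S_ge 5; have := @opp 2 isT; lia.
have E : #|S 0 :\: S 6| <= #|X 0 :\: S 6| + #|S 0 :\: X 0| by card_pointwise u; mem_cases.
have := cardsID (X 0) (S 0); rewrite (setIidPr (XS _)).
have := cardsID (S 6) (S 0); have := cardsID (S 0) (S 6); rewrite setIC.
have := S_atyp 0; have := S_ge 0; have := @S_le 6 isT; lia.
Qed.

(** A vertex typical for both [S 0] and [S 6] has its next neighbourhood close to
    both [S 1] and [S 7]. *)
Let wrap1 : #|S 1 :\: S 7| <= 24 * eps /\ #|S 7 :\: S 1| <= 24 * eps.
Proof.
have [w] : exists w, w \in X 0 :&: X 6.
  apply/set0Pn; rewrite -card_gt0.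
  have E : #|S 0| <= #|X 0 :&: X 6| + #|S 0 :\: X 0| + #|S 0 :\: S 6| + #|S 6 :\: X 6|.
    by card_pointwise u; mem_cases.
  have := cardsID (X 0) (S 0); rewrite (setIidPr (XS _)).
  have := cardsID (X 6) (S 6); rewrite (setIidPr (XS _)).
  have := S_atyp 0; have := S_atyp 6; have := S_ge 0; have [] := wrap0; lia.
rewrite in_setI => /andP[w0 w6].
have [a1 a2] := @typ_next 0 w isT w0; have [b1 b2] := @typ_next 6 w isT w6.
have V7 : V 7 = V 1 by rewrite !V3.
have E1 : #|S 1 :\: S 7| <= #|S 1 :\: N w| + #|(V 7 :&: N w) :\: S 7|.
  by card_pointwise u; move: (subset_imp u (SV 1)); rewrite V7; mem_cases.
have E2 : #|S 7 :\: S 1| <= #|S 7 :\: N w| + #|(V 1 :&: N w) :\: S 1|.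
  by card_pointwise u; move: (subset_imp u (SV 7)); rewrite V7; mem_cases.
lia.
Qed.

Let V6 i : V i = V (i %% 6). Proof. by apply: (sys_mod3 sys); lia. Qed.

(** The sets of the walk are only approximately periodic; reducing the index
    modulo 6 replaces [S 6] by [S 0] and [S 7] by [S 1]. *)
Let nb_mod6 i v : v \in X (i %% 6) ->
  follows e (100 * eps) (V i.+1) (S (i.+1 %% 6)) (V i.+2) (S (i.+2 %% 6)) v.
Proof.
have fol0 j w : j <= 7 -> w \in X j ->
    follows e (24 * eps) (V j.+1) (S j.+1) (V j.+2) (S j.+2) w.
  move=> j7 wX; have [a1 a2] := typ_next (leqW j7) wX; have [b1 b2] := typ_prev j7 wX.
  by split; lia.
have [w1 w2] := wrap0; have [w3 w4] := wrap1.
rewrite (_ : V i.+1 = V (i %% 6).+1); last by apply: (sys_mod3 sys); lia.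
rewrite (_ : V i.+2 = V (i %% 6).+2); last by apply: (sys_mod3 sys); lia.
rewrite -(addn2 i) -(addn1 i) -(modnDml i 1) -(modnDml i 2).
rewrite (_ : 100 * eps = 24 * eps + 76 * eps); last by lia.
have: i %% 6 < 6 by rewrite ltn_mod.
move: (i %% 6) => [|[|[|[|[|[|//]]]]]] _ vX.
all: move: (fun h => fol0 _ v h vX) => /(_ isT) W.
all: apply: follows_close W _ _ _ _.
all: first [by rewrite setDv cards0 | by apply: leq_trans w1 _; lia
  | by apply: leq_trans w2 _; lia | by apply: leq_trans w3 _; lia
  | by apply: leq_trans w4 _; lia].
Qed.

Let opp_mod6 i : #|S (i %% 6) :&: S ((3 + i) %% 6)| <= 100 * eps.
Proof.
rewrite -modnDmr; have: i %% 6 < 6 by rewrite ltn_mod.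
move: (i %% 6) => [|[|[|[|[|[|//]]]]]] _.
1-3: by apply: leq_trans (opp _) _; rewrite ?leq_mul2r ?orbT.
all: by rewrite setIC; apply: leq_trans (opp _) _; rewrite ?leq_mul2r ?orbT.
Qed.

Lemma hexagon_of_chain :
  mu <= m + eps /\ exists S' X', hexagon e (100 * eps) m V S' X'.
Proof.
split; first exact: mu_le.
exists (fun i => S (i %% 6)), (fun i => X (i %% 6)).
split=> [i|i|i|i|i|i|i v|i] //=.
- by rewrite (V6 i).
- by have := S_atyp (i %% 6); lia.
- by have := @S_le (i %% 6); lia.
- exact: nb_mod6.
Qed.

End ChainOfNeighbourhoods.

(** * Existence of a hexagon *)

Section HexagonExists.
Set Implicit Arguments.
Unset Strict Implicit.

Variables (T : finType) (e : rel T).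
Hypothesis e_sym : symmetric e.
Local Notation N := (nb e).

(** Going from index i + a back to i is a shift by 5a, as 6a is 0 modulo 3 and
    modulo 6. *)
Lemma hexagon_unshift d m (V S X : nat -> {set T}) a :
  (forall i, V i.+3 = V i) ->
  hexagon e d m (fun i => V (i + a)) S X ->
  hexagon e d m V (fun i => S (i + 5 * a)) (fun i => X (i + 5 * a)).
Proof.
move=> V3 [per sub typ atyp ge le nbh opp].
have Va i : V (i + 5 * a + a) = V i.
  have red k q : V (k + q * 3) = V k.
    by elim: q => [|q IH]; rewrite ?addn0 // mulSn addnCA V3.
  by rewrite (_ : _ + a = i + (2 * a) * 3) ?red //; lia.
split=> [i|i|i|i|i|i|i v|i].
- by rewrite -addnA per.
- by rewrite -[V i]Va.
- exact: typ.
- exact: atyp.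
- exact: ge.
- exact: le.
- by move=> /nbh; rewrite -(Va i.+1) -(Va i.+2) !addSn.
- by rewrite -addnA; apply: opp.
Qed.

(** The walk starts at a vertex with the largest number of previous neighbours;
    the parts are shifted so that this vertex lies in part 1. *)
Lemma hexagon_exists n t mu eps (V : nat -> {set T}) v0 :
  sparse_system e n t mu eps V -> 500 * eps < mu -> v0 \in V 0 ->
  exists m S X, mu <= m + eps /\ hexagon e (100 * eps) m V S X.
Proof.
move=> sys mu_big v0V.
pose P k := [exists i : 'I_3, [exists v in V i, #|V i.+2 :&: N v| == k]].
have Pn k : P k -> k <= n.
  case/existsP=> i /existsP[v /andP[_ /eqP <-]].
  by apply: leq_trans (sys_size sys i.+2); rewrite subset_leq_card // subsetIl.
have Pi i v : v \in V i -> P #|V i.+2 :&: N v|.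
  move=> vV; apply/existsP; exists (inord (i %% 3)); apply/existsP; exists v.
  rewrite inordK ?ltn_mod // (sys_mod3 (j := i) sys) ?modn_mod // vV /=.
  by rewrite (sys_mod3 (j := i.+2) sys) //; lia.
have exP : exists k, P k by exists #|V 2 :&: N v0|; apply: (Pi 0).
have := ex_maxnP exP Pn; case=> M PM Mmax.
have Mn := Pn M PM.
case/existsP: PM => i /existsP[u /andP[uV /eqP uM]].
have sys' := sys_shift (i + 2) sys.
have Mm : n = n - M + M by lia.
have Mmax' j v : v \in V (j + (i + 2)) -> #|V (j.+2 + (i + 2)) :&: N v| <= M.
  by rewrite !addSn => /Pi; apply: Mmax.
have [||s sP] := chain_exists sys' Mm mu_big (u := u).
- by rewrite (_ : 1 + _ = i.+3) ?(sys_per sys) //; lia.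
- by rewrite add0n addn2.
have [mule [S [X hex]]] := hexagon_of_chain e_sym sys' Mm Mmax' mu_big sP.
exists (n - M); do 2!eexists; split; first exact: mule.
exact: hexagon_unshift (sys_per sys) hex.
Qed.

End HexagonExists.

(** * Two hexagons of opposite orientation *)

Section TwoHexagons.
Set Implicit Arguments.
Unset Strict Implicit.

Variables (T : finType) (e : rel T).
Hypothesis e_sym : symmetric e.
Local Notation N := (nb e).
Variables (n t mu eps d h m k : nat) (V S X U Y : nat -> {set T}).
Hypothesis sys : sparse_system e n t mu eps V.
Hypothesis hexS : hexagon e d m V S X.
Hypothesis hexU : hexagon e d k (fun i => V i.*2) U Y.
Hypotheses (mum : mu <= m + d) (muk : mu <= k + d) (eps_d : eps <= d).
Hypotheses (dh : 100 * d < h) (mu_big : n + 20 * h <= 5 * mu).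

Let V3 i : V i.+3 = V i := sys_per sys i.

(** If b has more than 2d neighbours in a set A whose typical elements B are all
    but d of A, then some light edge joins b to a typical element. *)
Lemma hit1 i b (A B : {set T}) : b \in V i -> A \subset V i.+1 -> B \subset A ->
  #|A| <= #|B| + d -> 2 * d < #|A :&: N b| ->
  exists x, [/\ x \in B, e b x & #|V i.+2 :&: N b :&: N x| <= eps].
Proof.
move=> bV AV BA AB big; apply: (sys_light_nb1 sys bV (subset_trans BA AV)).
have E : #|A :&: N b| <= #|B :&: N b| + #|A :\: B| by card_pointwise u; mem_cases.
have := cardsID B A; rewrite (setIidPr BA); lia.
Qed.

Lemma hit2 i b (A B : {set T}) : b \in V i -> A \subset V i.+2 -> B \subset A ->
  #|A| <= #|B| + d -> 2 * d < #|A :&: N b| ->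
  exists x, [/\ x \in B, e b x & #|V i.+1 :&: N b :&: N x| <= eps].
Proof.
move=> bV AV BA AB big; apply: (sys_light_nb2 sys bV (subset_trans BA AV)).
have E : #|A :&: N b| <= #|B :&: N b| + #|A :\: B| by card_pointwise u; mem_cases.
have := cardsID B A; rewrite (setIidPr BA); lia.
Qed.

(** A vertex typical for both hexagons would have about m neighbours in one of
    the other parts and about k in the other one. *)
Lemma opposite_disjoint a c : c.*2 = a %[mod 3] -> m + k + 4 * d < n ->
  #|S a :&: U c| <= 2 * d.
Proof.
move=> ca mk.
have XY0 : X a :&: Y c = set0.
  apply/setP => x; rewrite in_setI in_set0; apply/negbTE/negP => /andP[xX xY].
  have [_ s1 _ _] := hex_nb hexS xX; have [_ u1 _ _] := hex_nb hexU xY.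
  have E : V c.+1.*2 = V a.+2 by apply: (sys_mod3 sys); rewrite doubleS; lia.
  have xV := subsetP (hex_sub hexS a) _ (subsetP (hex_typ hexS a) _ xX).
  have := sys_deg sys xV; rewrite E in u1.
  have := hex_le hexS a.+1; have := hex_le hexU c.+1.
  have E1 : #|V a.+1 :&: N x| <= #|S a.+1| + #|(V a.+1 :&: N x) :\: S a.+1|.
    by card_pointwise u; mem_cases.
  have E2 : #|V a.+2 :&: N x| <= #|U c.+1| + #|(V a.+2 :&: N x) :\: U c.+1|.
    by card_pointwise u; mem_cases.
  lia.
have E : #|S a :&: U c| <= #|S a :\: X a| + #|U c :\: Y c| + #|X a :&: Y c|.
  by card_pointwise u; mem_cases.
have := cardsID (X a) (S a); rewrite (setIidPr (hex_typ hexS a)).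
have := cardsID (Y c) (U c); rewrite (setIidPr (hex_typ hexU c)).
have := hex_atyp hexS a; have := hex_atyp hexU c.
by move: E; rewrite XY0 cards0; lia.
Qed.

(** The only place where the partial degree must exceed n/5.  Otherwise b misses
    S_(i+4) in [V i.+1] and both S_(i+2), S_(i+5) in [V i.+2].  Since the sets
    U_c and U_(c+1) are almost completely joined and lie in the two parts of
    the neighbours of b, it also misses one of them, and one of U_(c+3) and
    U_(c+4).  The sets missed are almost disjoint, so the degree of b is at most
    about 2n - 3m - 2k. *)
Lemma not_exceptional i b : b \in V i ->
  #|S (3 + i.+1) :&: N b| <= h -> #|S i.+2 :&: N b| <= h -> h < #|S (3 + i.+2) :&: N b|.
Proof.
move=> bV h1 h2; rewrite ltnNge; apply/negP => h3.
have bd := sys_deg sys bV; have bd2 := sys_deg2 sys bV.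
have Vn1 := sys_size sys i.+1; have Vn2 := sys_size sys i.+2.
have S2V : S (3 + i.+2) \subset V i.+2 by rewrite -[V i.+2]V3; apply: (hex_sub hexS).
have S1V : S (3 + i.+1) \subset V i.+1 by rewrite -[V i.+1]V3; apply: (hex_sub hexS).
have Sdis := hex_opp hexS i.+2.
have mu2m : mu + 2 * m <= n + 2 * h + d.
  have E : #|V i.+2 :&: N b| + #|S i.+2| + #|S (3 + i.+2)| <=
     #|V i.+2| + #|S i.+2 :&: N b| + #|S (3 + i.+2) :&: N b| + #|S i.+2 :&: S (3 + i.+2)|.
    card_pointwise u.
    by move: (subset_imp u (hex_sub hexS i.+2)) (subset_imp u S2V); mem_cases.
  have := hex_ge hexS i.+2; have := hex_ge hexS (3 + i.+2); lia.
have U_part a c : c.*2 = a %[mod 3] -> U c \subset V a.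
  by move=> ca; rewrite -(sys_mod3 sys ca); apply: (hex_sub hexU).
(* U_c lies in V_(2c), and 2c = i + 2 modulo 3 *)
pose c := i.*2.+1.
have c2 : c.*2 = i.+2 %[mod 3] by rewrite /c; lia.
have c1 : c.+1.*2 = i.+1 %[mod 3] by rewrite /c; lia.
have c2' : (3 + c).*2 = i.+2 %[mod 3] by rewrite /c; lia.
have c1' : (3 + c.+1).*2 = i.+1 %[mod 3] by rewrite /c; lia.
have Udis := hex_opp hexU c; have Udis1 := hex_opp hexU c.+1.
have k2n : 2 * k <= n + d.
  have E : #|U c| + #|U (3 + c)| <= #|V i.+2| + #|U c :&: U (3 + c)|.
    card_pointwise u.
    by move: (subset_imp u (U_part _ _ c2)) (subset_imp u (U_part _ _ c2')); mem_cases.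
  have := hex_ge hexU c; have := hex_ge hexU (3 + c); lia.
have mk : m + k + 4 * d < n by lia.
have dich a : a.*2 = i.+2 %[mod 3] -> #|U a :&: N b| <= 2 * d \/ #|U a.+1 :&: N b| <= 2 * d.
  move=> a2; case: (leqP #|U a :&: N b| (2 * d)) => big; [by left|right].
  have [x [xY bx xl]] := hit2 bV (U_part _ _ a2) (hex_typ hexU a) (hex_atyp hexU a) big.
  have [u1 _ _ _] := hex_nb hexU xY.
  have Ua : U a.+1 \subset V i.+1 by apply: U_part; rewrite doubleS; lia.
  have E : #|U a.+1 :&: N b| <= #|V i.+1 :&: N b :&: N x| + #|U a.+1 :\: N x|.
    by card_pointwise u; move: (subset_imp u Ua); mem_cases.
  lia.
have disj a j : j.*2 = a %[mod 3] -> #|S a :&: U j| <= 2 * d.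
  by move=> ja; apply: opposite_disjoint.
have q1 := disj i.+2 c c2; have q2 := disj i.+2 (3 + c) c2'.
have E3 j : 3 + j = j %[mod 3] by rewrite modnDl.
have q3 := disj (3 + i.+2) c (etrans c2 (esym (E3 _))).
have q4 := disj (3 + i.+2) (3 + c) (etrans c2' (esym (E3 _))).
have q5 := disj (3 + i.+1) c.+1 (etrans c1 (esym (E3 _))).
have q6 := disj (3 + i.+1) (3 + c.+1) (etrans c1' (esym (E3 _))).
have m1 := hex_ge hexS i.+2; have m2 := hex_ge hexS (3 + i.+2); have m3 := hex_ge hexS (3 + i.+1).
have k1 := hex_ge hexU c; have k2 := hex_ge hexU (3 + c).
have k3 := hex_ge hexU c.+1; have k4 := hex_ge hexU (3 + c.+1).
have UV1 := U_part _ _ c2; have UV2 := U_part _ _ c2'.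
have UV3 := U_part _ _ c1; have UV4 := U_part _ _ c1'.
have SV := hex_sub hexS i.+2.
have D1 := dich c c2; have D2 := dich (3 + c) c2'.
clear c2 c1 c2' c1' dich disj U_part k2n mu2m bd2.
case: D1 D2 => [l1|l1] [l2|l2].
- have E2 : #|V i.+2 :&: N b| + #|S i.+2| + #|S (3 + i.+2)| + #|U c| + #|U (3 + c)| <=
     #|V i.+2| + #|S i.+2 :&: N b| + #|S (3 + i.+2) :&: N b| + #|U c :&: N b| +
     #|U (3 + c) :&: N b| + #|S i.+2 :&: S (3 + i.+2)| + #|S i.+2 :&: U c| +
     #|S i.+2 :&: U (3 + c)| + #|S (3 + i.+2) :&: U c| + #|S (3 + i.+2) :&: U (3 + c)| +
     #|U c :&: U (3 + c)|.
    card_pointwise u; move: (subset_imp u SV) (subset_imp u S2V).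
    by move: (subset_imp u UV1) (subset_imp u UV2); mem_cases.
  have E1 : #|V i.+1 :&: N b| + #|S (3 + i.+1)| <= #|V i.+1| + #|S (3 + i.+1) :&: N b|.
    by card_pointwise u; move: (subset_imp u S1V); mem_cases.
  lia.
- have E2 : #|V i.+2 :&: N b| + #|S i.+2| + #|S (3 + i.+2)| + #|U c| <=
     #|V i.+2| + #|S i.+2 :&: N b| + #|S (3 + i.+2) :&: N b| + #|U c :&: N b| +
     #|S i.+2 :&: S (3 + i.+2)| + #|S i.+2 :&: U c| + #|S (3 + i.+2) :&: U c|.
    by card_pointwise u; move: (subset_imp u SV) (subset_imp u S2V) (subset_imp u UV1); mem_cases.
  have E1 : #|V i.+1 :&: N b| + #|S (3 + i.+1)| + #|U (3 + c.+1)| <= #|V i.+1| +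
     #|S (3 + i.+1) :&: N b| + #|U (3 + c.+1) :&: N b| + #|S (3 + i.+1) :&: U (3 + c.+1)|.
    by card_pointwise u; move: (subset_imp u S1V) (subset_imp u UV4); mem_cases.
  rewrite -[(3 + c).+1]/(3 + c.+1) in l2; lia.
- have E2 : #|V i.+2 :&: N b| + #|S i.+2| + #|S (3 + i.+2)| + #|U (3 + c)| <=
     #|V i.+2| + #|S i.+2 :&: N b| + #|S (3 + i.+2) :&: N b| + #|U (3 + c) :&: N b| +
     #|S i.+2 :&: S (3 + i.+2)| + #|S i.+2 :&: U (3 + c)| + #|S (3 + i.+2) :&: U (3 + c)|.
    by card_pointwise u; move: (subset_imp u SV) (subset_imp u S2V) (subset_imp u UV2); mem_cases.
  have E1 : #|V i.+1 :&: N b| + #|S (3 + i.+1)| + #|U c.+1| <= #|V i.+1| +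
     #|S (3 + i.+1) :&: N b| + #|U c.+1 :&: N b| + #|S (3 + i.+1) :&: U c.+1|.
    by card_pointwise u; move: (subset_imp u S1V) (subset_imp u UV3); mem_cases.
  lia.
have E2 : #|V i.+2 :&: N b| + #|S i.+2| + #|S (3 + i.+2)| <=
   #|V i.+2| + #|S i.+2 :&: N b| + #|S (3 + i.+2) :&: N b| + #|S i.+2 :&: S (3 + i.+2)|.
  by card_pointwise u; move: (subset_imp u SV) (subset_imp u S2V); mem_cases.
have E1 : #|V i.+1 :&: N b| + #|S (3 + i.+1)| + #|U c.+1| + #|U (3 + c.+1)| <= #|V i.+1| +
   #|S (3 + i.+1) :&: N b| + #|U c.+1 :&: N b| + #|U (3 + c.+1) :&: N b| +
   #|S (3 + i.+1) :&: U c.+1| + #|S (3 + i.+1) :&: U (3 + c.+1)| + #|U c.+1 :&: U (3 + c.+1)|.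
  by card_pointwise u; move: (subset_imp u S1V) (subset_imp u UV3) (subset_imp u UV4); mem_cases.
rewrite -[(3 + c).+1]/(3 + c.+1) in l2; lia.
Qed.

(** A light edge from b to a typical vertex x of some S_j forces b to miss what x
    is joined to.  Applied to S_(i+2) it contradicts the partial degree of b, to
    S_(i+5) it puts the next neighbourhood of b inside S_(i+1), and to S_(i+1)
    it makes b miss S_(i+2).  The degree of b then leaves no room for
    further exceptions. *)
Lemma follows_of_few i b : b \in V i -> #|S (3 + i.+1) :&: N b| <= h ->
  follows e (5 * d) (V i.+1) (S i.+1) (V i.+2) (S i.+2) b.
Proof.
move=> bV h1; have bd := sys_deg sys bV; have bd1 := sys_deg1 sys bV.
have h2 : #|S i.+2 :&: N b| <= h.
  rewrite leqNgt; apply/negP => big.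
  have [|x [xX bx xl]] := hit2 bV (hex_sub hexS i.+2) (hex_typ hexS i.+2) (hex_atyp hexS i.+2).
    by lia.
  have [_ _ _] := hex_nb hexS xX; rewrite V3 -[S i.+4]/(S (3 + i.+1)) => p.
  have E : #|V i.+1 :&: N b| <= #|S (3 + i.+1) :&: N b| +
     #|V i.+1 :&: N b :&: N x| + #|(V i.+1 :\: S (3 + i.+1)) :\: N x|.
    by card_pointwise u; mem_cases.
  lia.
have h3 := not_exceptional bV h1 h2.
have S2V : S (3 + i.+2) \subset V i.+2 by rewrite -[V i.+2]V3; apply: (hex_sub hexS).
have f2 : #|(V i.+1 :&: N b) :\: S i.+1| <= 2 * d.
  have [|x [xX bx xl]] := hit2 bV S2V (hex_typ hexS _) (hex_atyp hexS _).
    by lia.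
  have [_ _ _] := hex_nb hexS xX.
  rewrite -[(3 + i.+2).+2]/(6 + i.+1) (hex_per hexS) -[6 + i.+1]/(3 + (3 + i.+1)) !V3 => p.
  have E : #|(V i.+1 :&: N b) :\: S i.+1| <= 
     #|V i.+1 :&: N b :&: N x| + #|(V i.+1 :\: S i.+1) :\: N x|.
    by card_pointwise u; mem_cases.
  lia.
have f3 : #|S i.+2 :&: N b| <= 2 * d.
  have [|x [xX bx xl]] := hit1 bV (hex_sub hexS i.+1) (hex_typ hexS i.+1) (hex_atyp hexS i.+1).
    have E : #|V i.+1 :&: N b| <= #|S i.+1 :&: N b| + #|(V i.+1 :&: N b) :\: S i.+1|.
      by card_pointwise u; mem_cases.
    by lia.
  have [p _ _ _] := hex_nb hexS xX.
  have E : #|S i.+2 :&: N b| <= #|V i.+2 :&: N b :&: N x| + #|S i.+2 :\: N x|.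
    by card_pointwise u; move: (subset_imp u (hex_sub hexS i.+2)); mem_cases.
  lia.
have E1 : #|S i.+1 :\: N b| + #|V i.+1 :&: N b| <= #|S i.+1| + #|(V i.+1 :&: N b) :\: S i.+1|.
  by card_pointwise u; mem_cases.
have E2 : #|(V i.+2 :\: S i.+2) :\: N b| + #|S i.+2| + #|V i.+2 :&: N b| <=
    #|V i.+2| + #|S i.+2 :&: N b|.
  by card_pointwise u; move: (subset_imp u (hex_sub hexS i.+2)); mem_cases.
have := sys_size sys i.+2; have := hex_ge hexS i.+2; have := hex_le hexS i.+1.
by split; lia.
Qed.

Let H i : {set T} := [set v in V i | #|S (3 + i.+1) :&: N v| <= h].

Let H_follows i v : v \in H i -> follows e (5 * d) (V i.+1) (S i.+1) (V i.+2) (S i.+2) v.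
Proof. by rewrite inE => /andP[]; apply: follows_of_few. Qed.

Let H_sub i : H i \subset V i.
Proof. by apply/subsetP => v; rewrite inE => /andP[]. Qed.

Let H_big i : n <= 5 * #|H i|.
Proof.
have: #|X i| <= #|H i|.
  apply/subset_leq_card/subsetP => v vX; have [_ p _ _] := hex_nb hexS vX.
  rewrite inE (subsetP (hex_sub hexS i)) ?(subsetP (hex_typ hexS i)) //=.
  have S1V : S (3 + i.+1) \subset V i.+1 by rewrite -[V i.+1]V3; apply: (hex_sub hexS).
  have E : #|S (3 + i.+1) :&: N v| <=
      #|(V i.+1 :&: N v) :\: S i.+1| + #|S i.+1 :&: S (3 + i.+1)|.
    by card_pointwise u; move: (subset_imp u S1V); mem_cases.
  by have := hex_opp hexS i.+1; lia.
have := hex_atyp hexS i; have := hex_ge hexS i; lia.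
Qed.

Hypothesis no_octahedron : forall x y z, ~~ octahedron e x y z.
Variable tau : nat.
Hypotheses (tau_t : 2 * tau <= t) (n0 : 0 < n) (gh : 4 * (2 * (6 * d) + 1) * n <= h ^ 2)
  (tauh : 4 * n <= tau * h) (tauh2 : 20 * n ^ 3 < (tau * h) ^ 2).

(** The extra neighbours of v lie in [V i.+1] minus [H i.+1], whose vertices have
    many neighbours in S_(i+5), or in [H i.+2], whose vertices are joined to
    almost all of S_(i+1).  The vertices of [H i] are joined to almost all of
    S_(i+5) and S_(i+1), so edges of either kind would give an octahedron. *)
Lemma few_extra i : exists2 v, v \in H i &
  #|(V i.+1 :\: H i.+1) :&: N v| + #|H i.+2 :&: N v| < t.
Proof.
apply/exists_inP; apply: contraT; rewrite negb_exists_in => /forall_inP big.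
have S2V : S (3 + i.+2) \subset V i.+2 by rewrite -[V i.+2]V3; apply: (hex_sub hexS).
have few (F A B : {set T}) : #|A| <= n -> #|B| <= n ->
    (forall x, x \in F -> tau <= #|A :&: N x|) ->
    (forall x, x \in F -> #|B :\: N x| <= 6 * d) ->
    (forall s, s \in A -> h <= #|B :&: N s|) -> 10 * #|F| < n.
  move=> An Bn FA FB AB.
  have := few_rich_vertices no_octahedron n0 An Bn FA FB AB gh tauh.
  rewrite ltnNge => le; apply/negP => nF; move: tauh2; rewrite ltnNge => /negP[].
  rewrite -(leq_pmul2l n0); apply: leq_trans (_ : 10 * #|F| * (tau * h) ^ 2 <= _).
    by rewrite leq_mul2r nF orbT.
  by rewrite (expnS n 3) in le; lia.
pose F1 := [set x in H i | tau <= #|(V i.+1 :\: H i.+1) :&: N x|].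
pose F2 := [set x in H i | tau <= #|H i.+2 :&: N x|].
have F1n : 10 * #|F1| < n.
  apply: (few F1 (V i.+1 :\: H i.+1) (S (3 + i.+2))).
  - exact: leq_trans (subset_leq_card (subsetDl _ _)) (sys_size sys _).
  - exact: leq_trans (subset_leq_card S2V) (sys_size sys _).
  - by move=> x; rewrite inE => /andP[].
  - move=> x; rewrite inE => /andP[/H_follows[_ _ _ p] _].
    have E : #|S (3 + i.+2) :\: N x| <=
        #|(V i.+2 :\: S i.+2) :\: N x| + #|S i.+2 :&: S (3 + i.+2)|.
      by card_pointwise u; move: (subset_imp u S2V); mem_cases.
    by have := hex_opp hexS i.+2; lia.
  - move=> s; rewrite inE => /andP[+ sV]; rewrite inE sV -ltnNge; lia.
have F2n : 10 * #|F2| < n.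
  apply: (few F2 (H i.+2) (S i.+1)).
  - exact: leq_trans (subset_leq_card (H_sub _)) (sys_size sys _).
  - exact: leq_trans (subset_leq_card (hex_sub hexS _)) (sys_size sys _).
  - by move=> x; rewrite inE => /andP[].
  - by move=> x; rewrite inE => /andP[/H_follows[p _ _ _] _]; lia.
  - move=> s /H_follows[_ _ _]; rewrite V3 -[S i.+4]/(S (3 + i.+1)) => p.
    have E : #|S i.+1| <= #|S i.+1 :&: N s| + #|S i.+1 :&: S (3 + i.+1)| +
        #|(V i.+1 :\: S (3 + i.+1)) :\: N s|.
      by card_pointwise u; move: (subset_imp u (hex_sub hexS i.+1)); mem_cases.
    have := hex_opp hexS i.+1; have := hex_ge hexS i.+1; lia.
have: #|H i| <= #|F1| + #|F2|.
  apply: leq_trans (leq_card_setU _ _); apply/subset_leq_card/subsetP => x xH.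
  have [le1|gt1] := leqP tau #|(V i.+1 :\: H i.+1) :&: N x|.
    by apply/setUP; left; rewrite inE xH.
  by apply/setUP; right; rewrite inE xH /=; have := big x xH; rewrite -leqNgt; lia.
have := H_big i; lia.
Qed.

Lemma two_hexagons_contradiction : False.
Proof.
have dec i : #|H i.+2| < #|H i.+1|.
  have [v vH few] := few_extra i.
  have vV := subsetP (H_sub i) _ vH.
  have E1 : #|V i.+1 :&: N v| <= #|H i.+1| + #|(V i.+1 :\: H i.+1) :&: N v|.
    by card_pointwise u; mem_cases.
  have E2 : #|V i.+2 :&: N v| + #|H i.+2| <= #|V i.+2| + #|H i.+2 :&: N v|.
    by card_pointwise u; move: (subset_imp u (H_sub i.+2)); mem_cases.
  have := sys_deg sys vV; have := sys_size sys i.+2; lia.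
have: H 7 = H 1.
  by rewrite /H -[3 + 8]/(6 + 5) (hex_per hexS) !V3.
have := dec 0; have := dec 1; have := dec 2; have := dec 3; have := dec 4; have := dec 5.
by move=> + + + + + + E; rewrite E; lia.
Qed.

End TwoHexagons.

(** * Choice of the tolerances *)

Section Numbers.
Set Implicit Arguments.
Unset Strict Implicit.

Lemma quotient_bounds a n : 0 < a -> a <= n ->
  [/\ a * (n %/ a) <= n, n <= 2 * a * (n %/ a) & 1 <= n %/ a].
Proof.
move=> a0 an; have q1 : 1 <= n %/ a by rewrite divn_gt0.
have u := ltn_ceil n a0; have l := leq_trunc_div n a.
by split=> //; move: (n %/ a) q1 u l => x *; nia.
Qed.

(** Two dense links can be made to share a fixed proportion D of the n^2
    pairs; here D = n^2 / (64 q^4). *)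
Lemma common_link_size q n eps : 0 < q -> (2 ^ 15 * q ^ 8) <= n -> n <= 2 * q * eps ->
  exists D, [/\ 2 * n <= D, 2 * n ^ 3 <= D ^ 2 & 2 * n ^ 2 * D < (eps ^ 2) ^ 2].
Proof.
move=> q0 nq ne; have [w wE] : {w | w = 64 * q ^ 4} by exists (64 * q ^ 4).
have w0 : 0 < w by rewrite wE muln_gt0 expn_gt0 q0.
have wn : 8 * w ^ 2 <= n.
  by rewrite wE expnMn -expnM (_ : 8 * _ = 2 ^ 15 * q ^ 8) //; lia.
have e4 : n ^ 4 <= 16 * q ^ 4 * eps ^ 4 by rewrite -[16]/(2 ^ 4) -!expnMn leq_exp2r.
have n0 : 0 < n by apply: leq_trans wn; rewrite muln_gt0 expn_gt0 w0.
have ww : w <= w ^ 2 by rewrite -mulnn leq_pmulr.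
have wn2 : w <= n ^ 2 by rewrite -mulnn; clear - w0 wn n0 ww; nia.
have [D1 D2 D0] := quotient_bounds w0 wn2; exists (n ^ 2 %/ w).
move: (n ^ 2 %/ w) D1 D2 D0 => D D1 D2 D0.
split.
- have w4 : 4 * w <= n by clear - wn ww; lia.
  have a : 4 * w * n <= n ^ 2 by rewrite -mulnn leq_mul2r w4 orbT.
  rewrite -(@leq_pmul2l (2 * w)) ?muln_gt0 ?w0 //; clear - a D2; lia.
- have a1 : 8 * w ^ 2 * n ^ 3 <= n ^ 4 by rewrite (expnS n 3) leq_mul2r wn orbT.
  have a2 : n ^ 4 <= 4 * w ^ 2 * D ^ 2.
    have -> : n ^ 4 = (n ^ 2) ^ 2 by rewrite -expnM.
    by rewrite -[4]/(2 ^ 2) -!expnMn leq_exp2r.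
  rewrite -(@leq_pmul2l (4 * w ^ 2)) ?muln_gt0 ?expn_gt0 ?w0 //.
  by apply: leq_trans a2; apply: leq_trans a1; clear; lia.
rewrite -expnM -(ltn_pmul2l w0).
have a1 : w * (2 * n ^ 2 * D) <= 2 * n ^ 4.
  rewrite (_ : w * _ = 2 * n ^ 2 * (w * D)); last by clear; lia.
  by rewrite (_ : 2 * n ^ 4 = 2 * n ^ 2 * n ^ 2) ?leq_mul2l ?D1 ?orbT // -mulnA -expnD.
have a2 : 0 < q ^ 4 * eps ^ 4.
  rewrite muln_gt0 !expn_gt0 q0 /= orbF.
  by rewrite lt0n; apply: contraTneq ne => ->; rewrite muln0 -ltnNge.
by apply: leq_ltn_trans a1 _; rewrite wE -[2 * 2]/4; clear - a2 e4; lia.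
Qed.

(** The tolerance [100 * eps] of the hexagons has to be small even against the
    square of h / n, hence the factor C^2 in q. *)
Lemma tolerances C n q : q = 200 ^ 2 * C ^ 2 -> 0 < C -> q <= n ->
  let eps := n %/ q in let h := n %/ C in
  100 * (100 * eps) < h /\ 4 * (2 * (6 * (100 * eps)) + 1) * n <= h ^ 2.
Proof.
move=> qE C0 qn.
have q0 : 0 < q by rewrite qE muln_gt0 !expn_gt0 C0.
have CC : C <= C ^ 2 by rewrite -mulnn leq_pmulr.
have Cn : C <= n by clear - CC qE qn; lia.
have [e1 _ e0] := quotient_bounds q0 qn; have [_ h2 h0] := quotient_bounds C0 Cn.
rewrite /=; move: (n %/ q) (n %/ C) e1 e0 h2 h0 => eps h e1 e0 h2 h0.
have b : 200 * 100 * C * eps <= h.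
  rewrite -(@leq_pmul2l (2 * C)) ?muln_gt0 ?C0 //.
  apply: leq_trans h2; apply: leq_trans e1; rewrite qE -mulnn; clear; lia.
split; first by clear - b C0 e0; nia.
have n2 : n ^ 2 <= 4 * C ^ 2 * h ^ 2 by rewrite -[4]/(2 ^ 2) -!expnMn leq_exp2r.
rewrite -(@leq_pmul2l (4 * C ^ 2)) ?muln_gt0 ?expn_gt0 ?C0 //.
apply: leq_trans n2; rewrite -mulnn mulnA leq_mul2r; apply/orP; right.
apply: leq_trans e1; rewrite qE.
have e5 : 16 * (2 * (6 * (100 * eps)) + 1) <= 200 ^ 2 * eps by clear - e0; lia.
by have := leq_mul (leqnn (C ^ 2)) e5; clear; lia.
Qed.

Lemma few_of_weighted q n eps k : n <= 2 * q * eps -> 1 <= eps ->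
  k * eps ^ 2 <= 2 * n ^ 2 -> k <= 8 * q ^ 2.
Proof.
move=> ne e0 kn; rewrite -(@leq_pmul2r (eps ^ 2)) ?expn_gt0 ?e0 //.
have : n ^ 2 <= 4 * q ^ 2 * eps ^ 2 by rewrite -[4]/(2 ^ 2) -!expnMn leq_exp2r.
by clear - kn; lia.
Qed.

Lemma half_surplus q n t k : 0 < q -> k <= 8 * q ^ 2 -> 2 ^ 15 * q ^ 8 <= n ->
  10 ^ 6 * n <= t ^ 2 -> t <= 2 * (t - 6 * k).
Proof.
move=> q0 kq nq tn; suff: 100 * q ^ 2 <= t by clear - kq; lia.
rewrite -leq_sqr; apply: leq_trans tn; apply: leq_trans (_ : 10 ^ 6 * q ^ 8 <= _).
  by rewrite expnMn -expnM leq_mul // leq_pexp2l.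
by rewrite leq_mul2l; apply/orP; right; apply: leq_trans nq; rewrite leq_pmull.
Qed.

Lemma extra_edges_enough C n h t tau : 0 < C -> 0 < n -> n <= 2 * C * h ->
  10 ^ 6 * C ^ 2 * n <= t ^ 2 -> t <= 5 * tau ->
  4 * n <= tau * h /\ 20 * n ^ 3 < (tau * h) ^ 2.
Proof.
move=> C0 n0 nh tn tt.
have a : t ^ 2 * n ^ 2 <= 100 * C ^ 2 * (tau * h) ^ 2.
  by rewrite -[100]/(10 ^ 2) -!expnMn leq_exp2r //; clear - nh tt; nia.
have b : 10 ^ 4 * n ^ 3 <= (tau * h) ^ 2.
  rewrite -(@leq_pmul2l (100 * C ^ 2)) ?muln_gt0 ?expn_gt0 ?C0 //.
  apply: leq_trans a; apply: (@leq_trans (10 ^ 6 * C ^ 2 * n * n ^ 2)).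
    by rewrite (expnS n 2); clear; lia.
  by rewrite leq_mul2r tn orbT.
have n3 : 0 < n ^ 3 by rewrite expn_gt0 n0.
split; last by clear - b n3; lia.
have n23 : n ^ 2 <= n ^ 3 by rewrite leq_pexp2l.
by rewrite -leq_sqr expnMn; clear - b n23; lia.
Qed.

Lemma deletion_small C n q : q = 200 ^ 2 * C ^ 2 -> 0 < C -> 2 ^ 15 * q ^ 8 <= n ->
  [/\ q <= n, 3 * (8 * q ^ 2) < n & 8 * q ^ 2 <= n %/ C].
Proof.
move=> qE C0 nq.
have q0 : 0 < q by rewrite qE muln_gt0 !expn_gt0 C0.
have Cq : C <= q by rewrite qE -mulnn !mulnA leq_pmull // !muln_gt0 C0.
have q2 : q <= q ^ 2 by rewrite -mulnn leq_pmulr.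
have q3 : q ^ 2 <= q ^ 3 by rewrite leq_pexp2l.
have q8 : q ^ 3 <= q ^ 8 by rewrite leq_pexp2l.
split; [by clear - nq q2 q3 q8; lia|by clear - nq q2 q3 q8 q0; lia|].
rewrite leq_divRL //; apply: leq_trans (_ : 8 * q ^ 2 * q <= _).
  by rewrite leq_mul2l Cq orbT.
by rewrite -mulnA -expnSr; clear - nq q8; lia.
Qed.

End Numbers.

(** * Deleting the vertices with dense links *)

Section Cleaning.
Set Implicit Arguments.
Unset Strict Implicit.

Variables (T : finType) (e : rel T).
Hypothesis e_sym : symmetric e.
Local Notation N := (nb e).

Lemma card_link (P Q : {set T}) v :
  #|link e P Q v| = \sum_(w in P) #|[set u in Q | [&& e v w, e v u & e w u]]|.
Proof.
rewrite (@card_pairs _ _ P Q); last by apply/subsetP => p; rewrite inE => /andP[].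
apply: eq_bigr => w wP; congr #|pred_of_set _|; apply/setP => u.
by rewrite !inE /= wP; case: (u \in Q).
Qed.

Lemma card_link_sym (P Q : {set T}) v : #|link e P Q v| = #|link e Q P v|.
Proof.
rewrite !card_link exchange_card; apply: eq_bigr => u _.
congr #|pred_of_set _|; apply/setP => w; rewrite !inE (e_sym w u).
by case: (e v w); case: (e v u).
Qed.

Lemma few_heavy_nbs (P Q : {set T}) v eps : #|link e P Q v| <= eps ^ 2 ->
  #|[set w in P :&: N v | eps < #|Q :&: N v :&: N w|]| <= eps.
Proof.
set H := [set _ in _ | _] => le; rewrite leqNgt; apply/negP => big.
have: #|H| * eps.+1 <= #|link e P Q v|.
  rewrite card_link -sum_nat_const big_mkcond [leqRHS]big_mkcond /=; apply: leq_sum => w _.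
  case: ifP => // ; rewrite inE in_setI inE => /andP[/andP[-> vw] lt].
  apply: leq_trans lt _; apply/subset_leq_card/subsetP => u; rewrite !inE vw.
  by case/andP=> /andP[-> ->] ->.
by move: big le => *; nia.
Qed.

(** Each of the three parts loses at most k vertices, so a degree into one part
    drops by at most 3k. *)
Lemma sparse_subsystem (n t mu eps k : nat) (W : nat -> {set T}) :
  (forall i, W i.+3 = W i) -> (forall i, #|W i| <= n) ->
  (forall i v, v \in W i -> n + t + 6 * k <= #|W i.+1 :&: N v| + #|W i.+2 :&: N v|) ->
  (forall i v, v \in W i -> mu + 3 * k <= #|W i.+1 :&: N v|) ->
  (forall i v, v \in W i -> mu + 3 * k <= #|W i.+2 :&: N v|) ->
  (forall i, #|[set v in W i | eps ^ 2 < #|link e (W i.+1) (W i.+2) v|]| <= k) ->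
  exists2 V, sparse_system e n t mu eps V & forall i, #|W i| <= #|V i| + 3 * k.
Proof.
move=> W3 Wn Wdeg Wd1 Wd2 few.
pose D i := [set v in W i | eps ^ 2 < #|link e (W i.+1) (W i.+2) v|].
pose K := D 0 :|: D 1 :|: D 2; pose V i := W i :\: K.
have Kk : #|K| <= 3 * k.
  apply: leq_trans (leq_card_setU _ _) _.
  apply: leq_trans (leq_add (leq_card_setU _ _) (leqnn _)) _.
  by have := few 0; have := few 1; have := few 2; rewrite -/(D 0) -/(D 1) -/(D 2); lia.
have DK i : D i \subset K.
  have D3 j : D j.+3 = D j by rewrite /D !W3.
  suff: [/\ D i \subset K, D i.+1 \subset K & D i.+2 \subset K] by case.
  elim: i => [|i [IH1 IH2 IH3]]; last by rewrite D3.
  by split; apply/subsetP => v; rewrite !in_setU => ->; rewrite ?orbT.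
have lossless i v : #|W i :&: N v| <= #|V i :&: N v| + 3 * k.
  apply: leq_trans (leq_add (leqnn _) Kk); card_pointwise u; rewrite /V; mem_cases.
have VW i v : v \in V i -> v \in W i by rewrite in_setD => /andP[].
have light i v : v \in V i -> #|link e (W i.+1) (W i.+2) v| <= eps ^ 2.
  rewrite in_setD leqNgt => /andP[vK vW]; apply: contra vK => big.
  by apply: (subsetP (DK i)); rewrite inE vW.
have heavy (A B A' B' : {set T}) v : A \subset A' -> B \subset B' ->
    #|[set w in A :&: N v | eps < #|B :&: N v :&: N w|]| <=
    #|[set w in A' :&: N v | eps < #|B' :&: N v :&: N w|]|.
  move=> AA BB; apply/subset_leq_card/subsetP => w; rewrite !inE.
  case/andP=> /andP[/(subsetP AA) -> ->] lt /=; apply: leq_trans lt _.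
  by rewrite subset_leq_card // !setSI.
have sub i : V i \subset W i := subsetDl _ _.
exists V; last first.
  by move=> i; apply: leq_trans (leq_add (leqnn _) Kk); card_pointwise u; rewrite /V; mem_cases.
split=> [i|i|i v /VW vW|i v /VW vW|i v /VW vW|i v vV|i v vV].
- by rewrite /V W3.
- exact: leq_trans (subset_leq_card (sub i)) (Wn i).
- by have := Wdeg _ _ vW; have := lossless i.+1 v; have := lossless i.+2 v; lia.
- by have := Wd1 _ _ vW; have := lossless i.+1 v; lia.
- by have := Wd2 _ _ vW; have := lossless i.+2 v; lia.
- by apply: leq_trans (heavy _ _ _ _ v (sub _) (sub _)) _; apply/few_heavy_nbs/light.
- apply: leq_trans (heavy _ _ _ _ v (sub _) (sub _)) _; apply/few_heavy_nbs.
  by rewrite card_link_sym; apply: light.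
Qed.

Hypothesis e_irr : irreflexive e.

Lemma octahedron_exists (C n t mu q : nat) (W : nat -> {set T}) :
  q = 200 ^ 2 * C ^ 2 ->
  (forall i, W i.+3 = W i) -> (forall i, #|W i| = n) ->
  (forall i v, v \in W i -> n + t <= #|W i.+1 :&: N v| + #|W i.+2 :&: N v|) ->
  (forall i v, v \in W i -> mu <= #|W i.+1 :&: N v|) ->
  (forall i v, v \in W i -> mu <= #|W i.+2 :&: N v|) ->
  0 < C -> 2 ^ 15 * q ^ 8 <= n -> 10 ^ 6 * C ^ 2 * n <= t ^ 2 -> n + 35 * (n %/ C) <= 5 * mu ->
  exists x y z, octahedron e x y z.
Proof.
move=> qE W3 Wn Wdeg Wd1 Wd2 C0 nbig tbig mubig.
case: (boolP [exists x, exists y, exists z, octahedron e x y z]).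
  by case/existsP=> x /existsP[y /existsP[z o]]; exists x, y, z.
move=> /existsPn no1.
have no x y z : ~~ octahedron e x y z.
  by move: (no1 x) => /existsPn/(_ y)/existsPn/(_ z).
exfalso.
have [qn kn kh] := deletion_small qE C0 nbig.
have q0 : 0 < q by rewrite qE muln_gt0 !expn_gt0 C0.
have n0 : 0 < n by apply: leq_trans qn.
pose h := n %/ C; pose eps := n %/ q; pose k := 8 * q ^ 2.
have [dh gh] := tolerances qE C0 qn.
have [_ eps_ge eps0] := quotient_bounds q0 qn.
have Cn : C <= n by apply: leq_trans qn; rewrite qE -mulnn !mulnA leq_pmull // !muln_gt0 C0.
have [_ h_ge _] := quotient_bounds C0 Cn.
have [D [D3 D4 D5]] := common_link_size q0 nbig eps_ge.
have fewK i : #|[set v in W i | eps ^ 2 < #|link e (W i.+1) (W i.+2) v|]| <= k.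
  apply: few_of_weighted eps_ge eps0 _.
  apply: (few_dense_links (P := W i.+1) (Q := W i.+2) no _ _ _ D3 D4 D5) => [||v].
  - by rewrite Wn.
  - by rewrite Wn.
  - by rewrite inE => /andP[_ /ltnW].
have tbig1 : 10 ^ 6 * n <= t ^ 2.
  by apply: leq_trans tbig; rewrite leq_mul2r leq_pmulr ?orbT // expn_gt0 C0.
have t2 : t <= 2 * (t - 6 * k) := half_surplus q0 (leqnn _) nbig tbig1.
have t1000 : 10 ^ 3 <= t.
  by rewrite -leq_sqr -expnM; apply: leq_trans tbig1; rewrite leq_pmulr.
have [||||V sys VW] := @sparse_subsystem n (t - 6 * k) (mu - 3 * k) eps k W W3 _ _ _ _ fewK.
- by move=> i; rewrite Wn.
- by move=> i v /Wdeg; clear - t2 t1000; lia.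
- by move=> i v /Wd1; clear - mubig kh; rewrite /k; lia.
- by move=> i v /Wd2; clear - mubig kh; rewrite /k; lia.
have mub : n + 20 * h <= 5 * (mu - 3 * k) by clear - mubig kh; rewrite /k /h; lia.
have mue : 500 * eps < mu - 3 * k by move: dh mub; rewrite -/h -/eps; clear; lia.
have [v0 v0V] : exists v, v \in V 0.
  by apply/set0Pn; rewrite -card_gt0; have := VW 0; rewrite Wn; clear - kn; rewrite /k; lia.
have [m [S [X [mm hexS]]]] := hexagon_exists e_sym sys mue v0V.
have [l [U [Y [ml hexU]]]] := hexagon_exists e_sym (sys_reverse sys) mue v0V.
have tt : t <= 5 * (t - 6 * k)./2.
  by have := odd_double_half (t - 6 * k); rewrite -muln2; clear - t2 t1000; lia.
have [th th2] := extra_edges_enough C0 n0 h_ge tbig tt.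
apply: (two_hexagons_contradiction sys hexS hexU _ _ _ dh mub no _ n0 gh th th2).
- by apply: leq_trans mm _; rewrite leq_add2l leq_pmull.
- by apply: leq_trans ml _; rewrite leq_add2l leq_pmull.
- by rewrite leq_pmull.
- by have := odd_double_half (t - 6 * k); rewrite -muln2; clear; lia.
Qed.
End Cleaning.

(** * Balanced tripartite graphs *)

Section Statistics.
Set Implicit Arguments.
Unset Strict Implicit.

Lemma bigminn_le (I : finType) (P : pred I) (F : I -> nat) x0 i :
  P i -> \big[minn/x0]_(j | P j) F j <= F i.
Proof.
move=> Pi; have: i \in index_enum I by rewrite mem_index_enum.
elim: (index_enum I) => // j r IH; rewrite inE big_cons => /orP[/eqP <-|/IH le].
  by rewrite Pi geq_minl.
by case: ifP => // _; rewrite geq_min le orbT.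
Qed.

Variables (T : finType) (e : rel T).

Lemma degree_inE v (A : {set T}) : degree_in e v A = #|A :&: nb e v|.
Proof. by congr #|pred_of_set _|; apply/setP => w; rewrite !inE. Qed.

Lemma min_degree_le v : min_degree e <= #|nb e v|.
Proof. by rewrite -(setTI (nb e v)) -degree_inE; apply: bigminn_le. Qed.

Lemma min_partial_degree_le (V : 'I_3 -> {set T}) i v :
  v \notin V i -> min_partial_degree e V <= #|V i :&: nb e v|.
Proof.
move=> vV; rewrite -degree_inE; apply: leq_trans (bigminn_le _ _ (isT : predT i)) _.
exact: (bigminn_le (P := fun w => w \notin V i)).
Qed.

Variables (n : nat) (V : 'I_3 -> {set T}).
Hypothesis bal : balanced_tripartite n e V.
Let W i : {set T} := V (inord (i %% 3)).

Let W_next_disjoint i k v : v \in W i -> 0 < k < 3 -> v \notin W (i + k).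
Proof.
case: bal => _ _ dis _ _ vW k3; apply: contraTN vW => vW.
have /disjointFr-> // : [disjoint W (i + k) & W i].
apply: dis; rewrite -val_eqE /= !inordK ?ltn_mod //; lia.
Qed.

Let nb_split i v : v \in W i -> #|nb e v| <= #|W i.+1 :&: nb e v| + #|W i.+2 :&: nb e v|.
Proof.
case: bal => _ cover _ _ inner vW; apply: leq_trans (leq_card_setU _ _).
apply/subset_leq_card/subsetP => w; rewrite inE => vw.
have: w \in \bigcup_(j < 3) V j by rewrite cover.
case/bigcupP => j _ wj; rewrite !inE vw !andbT.
have {}wj : w \in W j by rewrite /W modn_small // inord_val.
have Wmod a b : a = b %[mod 3] -> W a = W b by rewrite /W => ->.
have /or3P[] : [|| j == i %[mod 3], j == i.+1 %[mod 3] | j == i.+2 %[mod 3]] by lia.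
- by move=> /eqP/Wmod E; rewrite E in wj; have := inner _ _ _ vW wj; rewrite vw.
- by move=> /eqP/Wmod <-; rewrite wj.
- by move=> /eqP/Wmod <-; rewrite wj orbT.
Qed.

(** C plays the role of the real c, rounded up; q is the reciprocal of the
    tolerance eps / n. *)
Lemma balanced_octahedron (C q t mu : nat) : q = 200 ^ 2 * C ^ 2 -> 0 < C ->
  2 ^ 15 * q ^ 8 <= n -> 10 ^ 6 * C ^ 2 * n <= t ^ 2 -> n + 35 * (n %/ C) <= 5 * mu ->
  n + t <= min_degree e -> mu <= min_partial_degree e V -> contains_copy K3_2 e.
Proof.
move=> qE C0 nq tn mun tdeg mudeg.
have [[sym irr] _ _ size _] := bal.
have [|||||x [y [z o]]] := @octahedron_exists T e sym C n t mu q W qE _ _ _ _ _ C0 nq tn mun.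
- by move=> i; rewrite /W -(addn3 i) modnDr.
- by move=> i; apply: size.
- move=> i v vW; apply: leq_trans tdeg _; apply: leq_trans (min_degree_le v) _.
  exact: nb_split.
- move=> i v vW; apply: leq_trans mudeg _; apply: min_partial_degree_le.
  by rewrite -(addn1 i) W_next_disjoint.
- move=> i v vW; apply: leq_trans mudeg _; apply: min_partial_degree_le.
  by rewrite -(addn2 i) W_next_disjoint.
exact: (octahedron_copy sym irr o).
Qed.

End Statistics.

Local Open Scope ring_scope.

Theorem theorem1p5 (R : realType) (c : R) (hc : 58 <= c) :
  exists n0 : nat, forall n : nat, (n0 <= n)%N ->
  forall (T : finType) (e : rel T) (V : 'I_3 -> {set T}),
    balanced_tripartite n e V ->
    n%:R + 30 ^+ 5 * c ^+ 4 * Num.sqrt n%:R <= (min_degree e)%:R :> R ->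
    (1 / 5 + 7 / c) * n%:R <= (min_partial_degree e V)%:R :> R ->
    contains_copy K3_2 e.
Proof.
have c0 : 0 < c by lra.
pose C := (Num.truncn c).+1.
have /andP[Cc cC] : C%:R - 1 <= c < C%:R.
  by have := Num.Theory.truncn_itv (ltW c0); rewrite /C -[in X in X - 1]natr1 addrK.
exists (2 ^ 15 * (200 ^ 2 * C ^ 2) ^ 8)%N => n nbig T e V bal hdeg hpdeg.
have r0 : 0 <= 30 ^+ 5 * c ^+ 4 * Num.sqrt n%:R :> R.
  by rewrite !mulr_ge0 ?exprn_ge0 ?sqrtr_ge0 ?ltW.
have nd : (n <= min_degree e)%N by rewrite -(ler_nat R); lra.
apply: (@balanced_octahedron _ _ n V bal C _ (min_degree e - n) (min_partial_degree e V)
  (erefl _) _ nbig) => //.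
- rewrite -(ler_nat R) natrM natrM !natrX natrB //.
  have le : 30 ^+ 5 * c ^+ 4 * Num.sqrt n%:R <= (min_degree e)%:R - n%:R :> R by lra.
  apply: le_trans (_ : (30 ^+ 5 * c ^+ 4 * Num.sqrt n%:R) ^+ 2 <= _); last first.
    by rewrite ler_pXn2r // nnegrE //; lra.
  rewrite 2!exprMn sqr_sqrtr ?ler0n // ler_wpM2r ?ler0n //.
  (* C <= c + 1 <= 2c *)
  have C2 : C%:R ^+ 2 <= 4 * c ^+ 2 :> R by nra.
  have c2 : c ^+ 2 <= (c ^+ 4) ^+ 2.
    by rewrite -exprM ler_weXn2l //; lra.
  have := ler0n R C; have : 0 <= c ^+ 2 by rewrite exprn_ge0 // ltW.
  move: (C%:R ^+ 2) (c ^+ 2) ((c ^+ 4) ^+ 2) C2 c2 => x y z *; lra.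
- rewrite -(ler_nat R) natrD !natrM.
  have : (n %/ C)%:R <= n%:R / c :> R.
    rewrite ler_pdivlMr //; apply: le_trans (_ : (n %/ C)%:R * C%:R <= _).
      by rewrite ler_wpM2l ?ler0n // ltW.
    by rewrite -natrM ler_nat leq_trunc_div.
  have -> : 35 * (n %/ C)%:R = 5 * (7 * (n %/ C)%:R) :> R by ring.
  have E : (1 / 5 + 7 / c) * n%:R = n%:R / 5 + 7 * (n%:R / c) :> R by field; rewrite gt_eqF.
  move: hpdeg; rewrite E; lra.
- by rewrite subnKC.
Qed.
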